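(* Let $G$ be a connected cubic graph of girth $\ell$, with non-backtracking matrix $B$. Then $$S(G)=\sum_{k=\ell}^{2\ell-1}\frac{\operatorname{tr}(B^k)}{k\,2^{k}},$$ and therefore $S(G)$ is an adjacency-spectral invariant (connected cubic graphs with the same adjacency spectrum have the same $S$). However, the long-face contribution $L(G)=\mathbb{E}[F]-S(G)$ is not determined by the adjacency spectrum: within each of the two families $\{G_1,G_2,G_3\}$ (on $16$ vertices) and $\{W_1,\dots,W_6\}$ (on $22$ vertices) given explicitly in the context, the members are adjacency-cospectral and have equal $S(G)$, but pairwise unequal $L(G)$.
   Context: All graphs are finite and simple; cubic means $3$-regular. The girth $\ell$ is the length of a shortest cycle. A dart of $G$ is an ordered pair $(u,v)$ with $uv\in E(G)$; its tail is $u$, its head is $v$, and $\alpha(u,v)=(v,u)$. A rotation system $\rho$ of $G$ assigns to each vertex $v$ a cyclic ordering of its neighbours; $\sigma_v(u)$ denotes the neighbour of $v$ following $u$. The face permutation on darts is $\phi_\rho(u,v)=(v,\sigma_v(u))$; its cycles are the faces of $\rho$, the length of a face is the length of that cycle, and $F(\rho)$ is the number of faces. $F_{<t}(\rho)$ and $F_{\ge t}(\rho)$ are the numbers of faces of length $<t$ and $\ge t$. Expectations are over $\rho$ uniformly random among the $2^n$ rotation systems of the $n$-vertex cubic graph $G$. Put $S(G)=\mathbb{E}[F_{<2\ell}]$ (the expected short-face contribution) and $L(G)=\mathbb{E}[F]-S(G)=\mathbb{E}[F_{\ge 2\ell}]$. The non-backtracking matrix $B$ is the $0/1$ matrix indexed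 by darts with $B_{d,d'}=1$ iff the head of $d$ is the tail of $d'$ and $d'\neq\alpha(d)$. Family on vertex set $\{0,\dots,15\}$ (edges written $i$-$j$): $G_1$: 0-7, 0-12, 0-14, 1-8, 1-9, 1-10, 2-8, 2-11, 2-12, 3-9, 3-11, 3-13, 4-9, 4-14, 4-15, 5-10, 5-12, 5-13, 6-10, 6-14, 6-15, 7-13, 7-15, 8-11. $G_2$: 0-6, 0-10, 0-11, 1-7, 1-11, 1-12, 2-8, 2-9, 2-10, 3-8, 3-13, 3-14, 4-9, 4-12, 4-13, 5-12, 5-14, 5-15, 6-13, 6-15, 7-14, 7-15, 8-10, 9-11. $G_3$: 0-5, 0-9, 0-10, 1-6, 1-10, 1-11, 2-7, 2-11, 2-12, 3-8, 3-12, 3-13, 4-9, 4-13, 4-14, 5-10, 5-12, 6-14, 6-15, 7-13, 7-15, 8-14, 8-15, 9-11. Family on vertex set $\{0,\dots,21\}$: $W_1$: 0-1, 0-2, 0-3, 1-16, 1-21, 2-17, 2-19, 3-18, 3-20, 4-12, 4-13, 4-15, 5-8, 5-9, 5-13, 6-7, 6-9, 6-12, 7-8, 7-11, 8-11, 9-10, 10-14, 10-16, 11-16, 12-18, 13-17, 14-17, 14-18, 15-19, 15-20, 19-21, 20-21. $W_2$: 0-1, 0-2, 0-3, 1-16, 1-19, 2-17, 2-18, 3-20, 3-21, 4-5, 4-6, 4-9, 5-14, 5-15, 6-7, 6-8, 7-10, 7-12, 8-11, 8-13, 9-10, 9-11, 10-19, 11-19, 12-16, 12-18, 13-16, 13-17,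 14-18, 14-21, 15-17, 15-20, 20-21. $W_3$: 0-1, 0-2, 0-3, 1-16, 1-21, 2-17, 2-18, 3-19, 3-20, 4-5, 4-6, 4-7, 5-14, 5-15, 6-12, 6-13, 7-8, 7-9, 8-9, 8-10, 9-11, 10-12, 10-16, 11-13, 11-16, 12-18, 13-17, 14-18, 14-20, 15-17, 15-19, 19-21, 20-21. $W_4$: 0-1, 0-2, 0-3, 1-18, 1-19, 2-3, 2-21, 3-20, 4-7, 4-16, 4-21, 5-8, 5-12, 5-17, 6-13, 6-14, 6-17, 7-11, 7-20, 8-9, 8-16, 9-10, 9-11, 10-14, 10-15, 11-13, 12-13, 12-14, 15-19, 15-20, 16-19, 17-18, 18-21. $W_5$: 0-1, 0-2, 0-3, 1-16, 1-21, 2-17, 2-18, 3-19, 3-20, 4-5, 4-6, 4-7, 5-14, 5-15, 6-8, 6-12, 7-9, 7-13, 8-9, 8-11, 9-11, 10-12, 10-13, 10-16, 11-16, 12-18, 13-17, 14-18, 14-20, 15-17, 15-19, 19-21, 20-21. $W_6$: 0-1, 0-2, 0-3, 1-16, 1-19, 2-17, 2-20, 3-18, 3-21, 4-5, 4-14, 4-15, 5-6, 5-9, 6-7, 6-8, 7-11, 7-13, 8-10, 8-12, 9-10, 9-11, 10-19, 11-19, 12-16, 12-18, 13-16, 13-17, 14-17, 14-18, 15-20, 15-21, 20-21. *)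

(* Defs.v *)
From HB Require Import structures.
From mathcomp Require Import all_boot all_order all_algebra.
From mathcomp Require Import fingroup perm algC.

Set Implicit Arguments.
Unset Strict Implicit.
Unset Printing Implicit Defensive.

Import GRing.Theory Num.Theory.

Record sgraph := SGraph {
  vert :> finType;
  adj : rel vert;
  adj_sym : symmetric adj;
  adj_irr : irreflexive adj
}.

Definition neighbours (G : sgraph) (v : G) : {set G} := [set u | adj v u].

Definition cubic (G : sgraph) : Prop := forall v : G, #|neighbours v| = 3.

Definition connected (G : sgraph) : Prop :=
  0 < #|G| /\ forall u v : G, connect (@adj G) u v.

(* [path.cycle e [:: u; v]] holds for every edge, hence the bound 2 < k. *)
Definition has_cycle_of_length (G : sgraph) (k : nat) : bool :=
  (2 < k) && [exists c : k.-tuple G, uniq c && path.cycle (@adj G) c].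

(* A cycle has at most #|G| vertices; on an acyclic graph the value is the
   arbitrary #|G|.+1. *)
Definition girth (G : sgraph) : nat :=
  find (has_cycle_of_length G) (iota 0 #|G|.+1).

Definition dart (G : sgraph) : finType := {d : G * G | adj d.1 d.2}.

Definition tail (G : sgraph) (d : dart G) : G := (val d).1.
Definition head (G : sgraph) (d : dart G) : G := (val d).2.

Lemma dart_rev_subproof (G : sgraph) (d : dart G) : adj (head d) (tail d).
Proof. by rewrite adj_sym; exact: (valP d). Qed.

Definition dart_rev (G : sgraph) (d : dart G) : dart G :=
  Sub (head d, tail d) (dart_rev_subproof d).

(* Cyclic orderings of A, encoded by their successor permutation: a single
   cycle through all of A, extended by the identity outside A. *)
Definition cyclic_ordering (T : finType) (A : {set T}) (s : {perm T}) : bool :=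
  perm_on A s && [forall u in A, porbit s u == A].

Definition rotation_system (G : sgraph) : finType :=
  {r : {ffun G -> {perm G}} | [forall v, cyclic_ordering (neighbours v) (r v)]}.

Definition rot (G : sgraph) (rho : rotation_system G) (v : G) : {perm G} :=
  val rho v.

Lemma face_fun_subproof (G : sgraph) (rho : rotation_system G) (d : dart G) :
  adj (head d) (rot rho (head d) (tail d)).
Proof.
have /forallP/(_ (head d))/andP[rhoN _] := valP rho.
have := perm_closed (tail d) rhoN.
by rewrite !inE dart_rev_subproof.
Qed.

Definition face_fun (G : sgraph) (rho : rotation_system G) (d : dart G) :
    dart G :=
  Sub (head d, rot rho (head d) (tail d)) (face_fun_subproof rho d).

Lemma face_fun_inj (G : sgraph) (rho : rotation_system G) :
  injective (face_fun rho).
Proof.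
move=> [[u v] /= uv] [[u' v'] /= uv'] /(congr1 val) /= [].
rewrite /rot /head /tail /= => eq_v; subst v' => /perm_inj eq_u.
by apply: val_inj; rewrite /= eq_u.
Qed.

Definition face_perm (G : sgraph) (rho : rotation_system G) : {perm dart G} :=
  perm (@face_fun_inj G rho).

(* A face is the set of darts of a cycle of [face_perm rho], so that its
   length is its cardinal. *)
Definition faces (G : sgraph) (rho : rotation_system G) : {set {set dart G}} :=
  porbits (face_perm rho).

Definition num_faces (G : sgraph) (rho : rotation_system G) : nat :=
  #|faces rho|.

Definition num_faces_lt (G : sgraph) (t : nat) (rho : rotation_system G) :
    nat :=
  #|[set f in faces rho | #|f| < t]|.

Local Open Scope ring_scope.

Definition expectation (G : sgraph) (X : rotation_system G -> nat) : rat :=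
  (\sum_(rho : rotation_system G) (X rho)%:R) / #|rotation_system G|%:R.

Definition short_faces (G : sgraph) : rat :=
  expectation (@num_faces_lt G (2 * girth G)%N).

Definition long_faces (G : sgraph) : rat :=
  expectation (@num_faces G) - short_faces G.

Definition nonbacktracking_mx (G : sgraph) : 'M[rat]_#|dart G| :=
  \matrix_(i, j) ((head (enum_val i) == tail (enum_val j))
                  && (enum_val j != dart_rev (enum_val i)))%:R.

Definition adjacency_mx (G : sgraph) : 'M[algC]_#|G| :=
  \matrix_(i, j) (adj (enum_val i) (enum_val j))%:R.

(* The eigenvalues of A listed with their algebraic multiplicities. *)
Definition spectrum (n : nat) (A : 'M[algC]_n) : seq algC :=
  sval (closed_field_poly_normal (char_poly A)).

Definition cospectral (G H : sgraph) : bool :=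
  perm_eq (spectrum (adjacency_mx G)) (spectrum (adjacency_mx H)).

Local Close Scope ring_scope.

Definition edge_rel (n : nat) (E : seq (nat * nat)) : rel 'I_n :=
  fun i j => (i != j) && (((val i, val j) \in E) || ((val j, val i) \in E)).

Lemma edge_rel_sym (n : nat) (E : seq (nat * nat)) :
  symmetric (@edge_rel n E).
Proof. by move=> i j; rewrite /edge_rel eq_sym orbC. Qed.

Lemma edge_rel_irr (n : nat) (E : seq (nat * nat)) :
  irreflexive (@edge_rel n E).
Proof. by move=> i; rewrite /edge_rel eqxx. Qed.

Definition graph_of_edges (n : nat) (E : seq (nat * nat)) : sgraph :=
  SGraph (@edge_rel_sym n E) (@edge_rel_irr n E).

Definition edges_G1 : seq (nat * nat) :=
  [:: (0, 7); (0, 12); (0, 14); (1, 8); (1, 9); (1, 10); (2, 8); (2, 11);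
      (2, 12); (3, 9); (3, 11); (3, 13); (4, 9); (4, 14); (4, 15); (5, 10);
      (5, 12); (5, 13); (6, 10); (6, 14); (6, 15); (7, 13); (7, 15);
      (8, 11)].

Definition edges_G2 : seq (nat * nat) :=
  [:: (0, 6); (0, 10); (0, 11); (1, 7); (1, 11); (1, 12); (2, 8); (2, 9);
      (2, 10); (3, 8); (3, 13); (3, 14); (4, 9); (4, 12); (4, 13); (5, 12);
      (5, 14); (5, 15); (6, 13); (6, 15); (7, 14); (7, 15); (8, 10);
      (9, 11)].

Definition edges_G3 : seq (nat * nat) :=
  [:: (0, 5); (0, 9); (0, 10); (1, 6); (1, 10); (1, 11); (2, 7); (2, 11);
      (2, 12); (3, 8); (3, 12); (3, 13); (4, 9); (4, 13); (4, 14); (5, 10);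
      (5, 12); (6, 14); (6, 15); (7, 13); (7, 15); (8, 14); (8, 15);
      (9, 11)].

Definition edges_W1 : seq (nat * nat) :=
  [:: (0, 1); (0, 2); (0, 3); (1, 16); (1, 21); (2, 17); (2, 19); (3, 18);
      (3, 20); (4, 12); (4, 13); (4, 15); (5, 8); (5, 9); (5, 13); (6, 7);
      (6, 9); (6, 12); (7, 8); (7, 11); (8, 11); (9, 10); (10, 14);
      (10, 16); (11, 16); (12, 18); (13, 17); (14, 17); (14, 18); (15, 19);
      (15, 20); (19, 21); (20, 21)].

Definition edges_W2 : seq (nat * nat) :=
  [:: (0, 1); (0, 2); (0, 3); (1, 16); (1, 19); (2, 17); (2, 18); (3, 20);
      (3, 21); (4, 5); (4, 6); (4, 9); (5, 14); (5, 15); (6, 7); (6, 8);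
      (7, 10); (7, 12); (8, 11); (8, 13); (9, 10); (9, 11); (10, 19);
      (11, 19); (12, 16); (12, 18); (13, 16); (13, 17); (14, 18); (14, 21);
      (15, 17); (15, 20); (20, 21)].

Definition edges_W3 : seq (nat * nat) :=
  [:: (0, 1); (0, 2); (0, 3); (1, 16); (1, 21); (2, 17); (2, 18); (3, 19);
      (3, 20); (4, 5); (4, 6); (4, 7); (5, 14); (5, 15); (6, 12); (6, 13);
      (7, 8); (7, 9); (8, 9); (8, 10); (9, 11); (10, 12); (10, 16);
      (11, 13); (11, 16); (12, 18); (13, 17); (14, 18); (14, 20); (15, 17);
      (15, 19); (19, 21); (20, 21)].

Definition edges_W4 : seq (nat * nat) :=
  [:: (0, 1); (0, 2); (0, 3); (1, 18); (1, 19); (2, 3); (2, 21); (3, 20);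
      (4, 7); (4, 16); (4, 21); (5, 8); (5, 12); (5, 17); (6, 13); (6, 14);
      (6, 17); (7, 11); (7, 20); (8, 9); (8, 16); (9, 10); (9, 11);
      (10, 14); (10, 15); (11, 13); (12, 13); (12, 14); (15, 19); (15, 20);
      (16, 19); (17, 18); (18, 21)].

Definition edges_W5 : seq (nat * nat) :=
  [:: (0, 1); (0, 2); (0, 3); (1, 16); (1, 21); (2, 17); (2, 18); (3, 19);
      (3, 20); (4, 5); (4, 6); (4, 7); (5, 14); (5, 15); (6, 8); (6, 12);
      (7, 9); (7, 13); (8, 9); (8, 11); (9, 11); (10, 12); (10, 13);
      (10, 16); (11, 16); (12, 18); (13, 17); (14, 18); (14, 20); (15, 17);
      (15, 19); (19, 21); (20, 21)].

Definition edges_W6 : seq (nat * nat) :=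
  [:: (0, 1); (0, 2); (0, 3); (1, 16); (1, 19); (2, 17); (2, 20); (3, 18);
      (3, 21); (4, 5); (4, 14); (4, 15); (5, 6); (5, 9); (6, 7); (6, 8);
      (7, 11); (7, 13); (8, 10); (8, 12); (9, 10); (9, 11); (10, 19);
      (11, 19); (12, 16); (12, 18); (13, 16); (13, 17); (14, 17); (14, 18);
      (15, 20); (15, 21); (20, 21)].

Definition family16 (i : 'I_3) : sgraph :=
  graph_of_edges 16 (tnth [tuple edges_G1; edges_G2; edges_G3] i).

Definition family22 (i : 'I_6) : sgraph :=
  graph_of_edges 22
    (tnth [tuple edges_W1; edges_W2; edges_W3; edges_W4; edges_W5; edges_W6] i).

(* Main.v *)
From Stdlib Require Import BinNat.
Require Import Defs.
From HB Require Import structures.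
From mathcomp Require Import all_boot all_order all_algebra.
From mathcomp Require Import fingroup perm algC.
From mathcomp Require Import ring.

(* Makes [head] the head of a dart again, rather than that of a sequence. *)
Import Defs.

Set Implicit Arguments.
Unset Strict Implicit.
Unset Printing Implicit Defensive.

Import GRing.Theory Num.Theory.
Local Open Scope ring_scope.

(**
Short faces.  Since every vertex has degree 3, a face is a closed
non-backtracking walk.  If such a walk passes twice through a vertex, it splits
there into two shorter closed non-backtracking walks, each of which contains a
cycle, so its length is at least twice the girth l
([nb_cycle_uniq_tails]).  Hence for k < 2l the closed non-backtracking walks of
length k visit k distinct vertices, and such a walk w is a face of rho exactly
when the rotation at each of these vertices has one prescribed value out of the
two possible ones: the probability is 2^-k ([card_rotations_face]).  There are
tr(B^k) based closed walks, and k of them give the same face; below the girth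
there are none.  This gives [short_faces_trace].

Spectral invariance.  Write S and T for the head and tail incidence matrices
and P for dart reversal.  Then B = S T - P, T S is the adjacency matrix A,
T P S = 3 and P^2 = 1, so that B^k = S U + P S V + (-P)^k, where the products
of U and V with S and P S obey a recursion involving only A.  Hence tr(B^k) is
a function of the number of vertices and of A, which does not change when A is
conjugated ([trace_nb_power], [nb_coef_intertwine]).  Two cospectral real
symmetric matrices are similar
([normal_similar]), so they give the same traces.  The girth is also determined,
being the least k > 0 with tr(B^k) <> 0.

Long faces.  Within a family it remains to see that the graphs are cospectral
and that the sums of F(rho) over all rotation systems differ.

Cospectrality is certified by a 0/1 matrix Q with A1 Q = Q A2 and
Q Q^T = A1^2, which is invertible because A1 is; then A1^-1 Q is an orthogonal
matrix conjugating A2 to A1 ([cospectral_certificateP]).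

The sum of F(rho) has 2^22 terms for the larger graphs, and is obtained by
dynamic programming.  Adding the arcs d -> phi(d) of the face permutation one
after the other turns the darts into a collection of directed path fragments;
every arc either joins two fragments or closes one up into a face
([add_arcs_porbits]).  What happens next depends only on which dart ends and
which dart begins each open fragment, so after processing some of the vertices
it suffices to know how many choices lead to each such pairing: few pairings
occur if the processed vertices have few edges to the others
([closings_dpE], [sum_num_faces]).
*)

(** * The two rotations at a vertex of degree 3 *)

Local Open Scope nat_scope.

Definition cyc3 (T : finType) (x y z : T) : {perm T} :=
  (tperm x y * tperm x z)%g.

Section ThreeCycle.
Variables (T : finType) (x y z : T).
Hypothesis xyzU : uniq [:: x; y; z].

Let neq : [/\ x != y, x != z & y != z].
Proof. by case/and3P: xyzU; rewrite !inE negb_or => /andP[-> ->] ->. Qed.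

Lemma cyc3E u :
  cyc3 x y z u = if u == x then y else if u == y then z
                 else if u == z then x else u.
Proof.
have [xy xz yz] := neq; rewrite permM.
have [->|ux] := eqVneq u x.
  by rewrite tpermL tpermD // eq_sym.
have [->|uy] := eqVneq u y; first by rewrite tpermR tpermL.
rewrite (@tpermD _ x y) 1?eq_sym //.
have [->|uz] := eqVneq u z; first by rewrite tpermR.
by rewrite tpermD // eq_sym.
Qed.

Lemma cyc3_cyclic : cyclic_ordering [set x; y; z] (cyc3 x y z).
Proof.
have [xy xz yz] := neq; apply/andP; split.
  apply/subsetP=> u; rewrite !inE cyc3E.
  by do 3!case: (u == _) => //; rewrite eqxx.
suff: porbit (cyc3 x y z) x = [set x; y; z].
  move=> eqx; apply/'forall_implyP=> u; rewrite -eqx => xu.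
  by rewrite eq_porbit_mem.
have cx : cyc3 x y z x = y by rewrite cyc3E eqxx.
have cy : cyc3 x y z y = z by rewrite cyc3E eq_sym (negPf xy) eqxx.
have cz : cyc3 x y z z = x.
  by rewrite cyc3E eq_sym (negPf xz) eq_sym (negPf yz) eqxx.
apply/setP=> u; rewrite !inE -orbA; apply/porbitP/or3P => [[i ->]|].
  elim: i => [|i IHi]; first by rewrite perm1; constructor 1.
  rewrite expgSr permM; case: IHi => /eqP->; rewrite ?cx ?cy ?cz.
  - by constructor 2.
  - by constructor 3.
  - by constructor 1.
case=> /eqP->; first by exists 0; rewrite perm1.
  by exists 1; rewrite expg1 cx.
by exists 2; rewrite expgS expg1 permM cx cy.
Qed.

End ThreeCycle.

Lemma uniq3_swap (T : eqType) (x y z : T) :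
  uniq [:: x; y; z] -> uniq [:: x; z; y].
Proof.
by rewrite /= !inE !negb_or andbC (eq_sym y z) andbT => /and3P[-> -> ->].
Qed.

Lemma card_set3 (T : finType) (x y z : T) :
  uniq [:: x; y; z] -> #|[set x; y; z]| = 3.
Proof.
move=> U; rewrite -[RHS](card_uniqP U); apply: eq_card => u.
by rewrite !inE orbA.
Qed.

(** No point of a 3-element orbit is fixed and no two are swapped, so the image
    of one point determines the whole cycle. *)
Lemma cyclic_ordering3 (T : finType) (x y z : T) (s : {perm T}) :
    uniq [:: x; y; z] ->
  cyclic_ordering [set x; y; z] s = (s == cyc3 x y z) || (s == cyc3 x z y).
Proof.
move=> U; have U' := uniq3_swap U.
have eqA : [set x; y; z] = [set x; z; y] by rewrite setUAC.
apply/idP/orP => [/andP[sA sO]|[/eqP->|/eqP->]]; first last.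
- by rewrite eqA; apply: cyc3_cyclic.
- exact: cyc3_cyclic.
have inA u : u \in [set x; y; z] -> s u \in [set x; y; z].
  by move=> uA; rewrite (perm_closed u sA).
have orbA u : u \in [set x; y; z] -> porbit s u = [set x; y; z].
  by move=> uA; apply/eqP; move/forallP/(_ u): sO; rewrite uA.
(* The orbit of any point is the whole set, so no smaller set is s-stable. *)
have no_small u (B : {set T}) : u \in [set x; y; z] -> u \in B ->
    (forall v, v \in B -> s v \in B) -> 2 < #|B|.
  move=> uA uB sB; rewrite -[X in X <= _](card_set3 U) -(orbA u uA).
  apply/subset_leq_card/subsetP=> v /porbitP[i ->].
  elim: i => [|i IHi]; first by rewrite perm1.
  by rewrite expgSr permM sB.
have no_fix u : u \in [set x; y; z] -> s u != u.
  move=> uA; apply/eqP=> su; have /no_small := uA => /(_ [set u]).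
  rewrite cards1 => h; suff: 2 < 1 by [].
  by apply: h; rewrite ?inE // => v /set1P->; rewrite su set11.
have no_swap u v : u \in [set x; y; z] -> s u = v -> s v != u.
  move=> uA su; apply/eqP=> sv; have := no_small u [set u; v] uA.
  rewrite cards2 => h; suff: 2 < (u != v).+1 by case: (u != v).
  apply: h; first by rewrite !inE eqxx.
  by move=> w /set2P[]->; rewrite ?su ?sv !inE eqxx ?orbT.
have xA : x \in [set x; y; z] by rewrite !inE eqxx.
have ext a b c : uniq [:: a; b; c] -> [set a; b; c] = [set x; y; z] ->
    s a = b -> s = cyc3 a b c.
  move=> Uabc eqabc sa; apply/permP=> u; rewrite cyc3E //.
  have aA : a \in [set x; y; z] by rewrite -eqabc !inE eqxx.
  have bA : b \in [set x; y; z] by rewrite -eqabc !inE eqxx orbT.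
  have cA : c \in [set x; y; z] by rewrite -eqabc !inE eqxx orbT.
  have sb : s b = c.
    have := inA _ bA; rewrite -eqabc !inE (negPf (no_swap _ _ aA sa)).
    by rewrite (negPf (no_fix _ bA)) => /eqP.
  have sc : s c = a.
    have := inA _ cA; rewrite -eqabc !inE (negPf (no_swap _ _ bA sb)).
    by rewrite (negPf (no_fix _ cA)) !orbF => /eqP.
  have [->//|ua] := eqVneq u a; have [->//|ub] := eqVneq u b.
  have [->//|uc] := eqVneq u c; apply: (out_perm sA).
  by rewrite -eqabc !inE (negPf ua) (negPf ub) (negPf uc).
have := inA _ xA; rewrite !inE (negPf (no_fix _ xA)) => /orP[/eqP sx|/eqP sx].
  by left; rewrite (ext x y z).
by right; rewrite (ext x z y).
Qed.

Lemma cards3P (T : finType) (A : {set T}) : #|A| = 3 ->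
  exists x y z,
    [/\ uniq [:: x; y; z], enum A = [:: x; y; z] & A = [set x; y; z]].
Proof.
move=> cA; have := enum_uniq (mem A); have := cardE A; rewrite cA.
have := @mem_enum _ (mem A).
case: (enum A) => [|x [|y [|z [|]]]] //= memA _ U; exists x, y, z; split=> //.
by apply/setP=> u; have := memA u; rewrite !inE orbA => <-.
Qed.

Lemma card_cyclic_ordering (T : finType) (A : {set T}) :
  #|A| = 3 -> #|[set s | cyclic_ordering A s]| = 2.
Proof.
case/cards3P=> x [y [z [U _ ->]]].
rewrite (_ : [set s | _] = [set cyc3 x y z; cyc3 x z y]); last first.
  by apply/setP=> s; rewrite !inE cyclic_ordering3.
rewrite cards2; case: eqP => // /permP/(_ x).
have U' := uniq3_swap U.
rewrite !cyc3E // eqxx => eyz; move: U => /and3P[_].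
by rewrite inE eyz eqxx.
Qed.

Lemma card_cyclic_ordering_succ (T : finType) (A : {set T}) (u w : T) :
    #|A| = 3 -> u \in A -> w \in A -> u != w ->
  #|[set s | cyclic_ordering A s & s u == w]| = 1.
Proof.
move=> cA uA wA uw.
have [t [U eqt]] : exists t, uniq [:: u; w; t] /\ A = [set u; w; t].
  have : #|A :\ u :\ w| = 1.
    by move: cA; rewrite (cardsD1 u) uA (cardsD1 w) !inE wA eq_sym uw => -[].
  case/eqP/cards1P=> t eqt; exists t.
  have /setP/(_ t) := eqt; rewrite !inE eqxx => /and3P[tw tu tA].
  split; first by rewrite /= !inE negb_or uw eq_sym tu eq_sym tw.
  apply/setP=> v; have /setP/(_ v) := eqt; rewrite !inE.
  have [->|] := eqVneq v u; first by rewrite uA.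
  by have [->|//] := eqVneq v w; rewrite wA orbT.
have U' := uniq3_swap U.
rewrite (_ : [set s | _ & _] = [set cyc3 u w t]) ?cards1 //.
apply/setP=> s; rewrite !inE eqt cyclic_ordering3 //.
have [->|ne] := eqVneq s (cyc3 u w t); first by rewrite cyc3E ?eqxx.
apply/negbTE; rewrite /= negb_and -implybE; apply/implyP=> /eqP->.
rewrite cyc3E // eqxx eq_sym.
by case/and3P: U => _; rewrite inE.
Qed.


(** * Closed non-backtracking walks and the girth *)

Section NonBacktracking.
Variable G : sgraph.

Definition nb_step : rel (dart G) :=
  fun d e => (head d == tail e) && (e != dart_rev d).

Lemma dart_eq (d e : dart G) : tail d = tail e -> head d = head e -> d = e.
Proof.
move=> et eh; apply: val_inj; rewrite [LHS]surjective_pairing.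
by rewrite [RHS]surjective_pairing; congr (_, _).
Qed.

Lemma adj_dart (d : dart G) : adj (tail d) (head d).
Proof. exact: (valP d). Qed.

Lemma tail_neq_head (d : dart G) : tail d != head d.
Proof. by apply/eqP=> e; have := adj_dart d; rewrite e adj_irr. Qed.

Lemma repeat_split (T : Type) (S : eqType) (f : T -> S) (s : seq T) :
    ~~ uniq (map f s) ->
  exists p1 x p2 y p3, s = p1 ++ x :: p2 ++ y :: p3 /\ f x = f y.
Proof.
elim: s => //= x s IHs; rewrite negb_and negbK => /orP[fx|/IHs].
  have [p2 [y [p3 [-> e]]]] : exists p2 y p3, s = p2 ++ y :: p3 /\ f x = f y.
    elim: s fx {IHs} => //= y s IHs; rewrite inE => /predU1P[e|/IHs].
      by exists [::], y, s.
    by case=> p2 [y' [p3 [-> e]]]; exists (y :: p2), y', p3.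
  by exists [::], x, p2, y, p3.
by case=> p1 [x' [p2 [y [p3 [-> e]]]]]; exists (x :: p1), x', p2, y, p3.
Qed.

Lemma cycle_length_le (k : nat) : has_cycle_of_length G k -> k <= #|G|.
Proof.
case/andP=> _ /existsP[c /andP[Uc _]].
by rewrite -(size_tuple c) -(card_uniqP Uc) max_card.
Qed.

Lemma girth_le (k : nat) : has_cycle_of_length G k -> girth G <= k.
Proof.
move=> cyc; rewrite /girth leqNgt; apply/negP=> lt_k.
have := before_find 0 lt_k.
by rewrite nth_iota ?ltnS ?cycle_length_le // add0n cyc.
Qed.

(** The walk need not be non-backtracking across its endpoint.  If no vertex is
    repeated it is itself a cycle, and otherwise the part between two visits of
    a vertex is a shorter walk of the same kind. *)
Lemma nb_closed_walk_cycle (d : dart G) (p : seq (dart G)) :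
    path nb_step d p -> tail d = head (last d p) ->
  exists2 k, k <= (size p).+1 & has_cycle_of_length G k.
Proof.
have [m] := ubnP (size p); elim: m d p => // m IHm d p /ltnSE le_pm dp closed.
have [U|/repeat_split] := boolP (uniq (map (@tail G) (d :: p))); last first.
  case=> p1 [x [p2 [y [p3 [dpE exy]]]]].
  have: sorted nb_step (p1 ++ x :: p2 ++ y :: p3) by rewrite -dpE.
  have szp : size p = size p1 + (size p2 + (size p3).+1).
    have := congr1 size dpE; rewrite /= !size_cat /= size_cat /= addnS.
    by case.
  case/cat_sorted2=> _; rewrite /= cat_path /=.
  case/and3P=> xp2 /andP[/eqP stepy _] _.
  have lt_p2 : size p2 < size p by rewrite szp addnCA !addnS ltnS leq_addr.
  have [||k le_k cyc_k] := IHm x p2 _ xp2.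
  - exact: leq_trans lt_p2 le_pm.
  - by rewrite stepy.
  by exists k; rewrite // (leq_trans le_k) // ltnS ltnW.
exists (size p).+1 => //; apply/andP; split.
  case: p dp closed {le_pm U} => [|e [|//]] /=.
    by move=> _ e; have := tail_neq_head d; rewrite e eqxx.
  case/andP=> /andP[/eqP he /negP not_rev] _ closed; case: not_rev.
  by apply/eqP/dart_eq; [rewrite -he | rewrite -closed].
have szt : size (map (@tail G) (d :: p)) == (size p).+1 by rewrite size_map.
apply/existsP; exists (Tuple szt); apply/andP; split=> //.
suff: path.cycle (@adj G) (map (@tail G) (d :: p)) by [].
rewrite cycle_map /path.cycle rcons_path; apply/andP; split.
  apply: sub_path dp => u v /andP[/eqP e _].
  by rewrite /relpre /= -e adj_dart.
by rewrite /relpre /= closed adj_dart.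
Qed.

Lemma nb_closed_walk_girth (d : dart G) (p : seq (dart G)) :
    path nb_step d p -> tail d = head (last d p) ->
  girth G <= (size p).+1.
Proof.
move=> dp closed; have [k le_k cyc_k] := nb_closed_walk_cycle dp closed.
exact: leq_trans (girth_le cyc_k) le_k.
Qed.

(** Two visits to a vertex split the walk into two closed non-backtracking
    walks, each at least as long as the girth. *)
Lemma nb_cycle_uniq_tails (w : seq (dart G)) :
  path.cycle nb_step w -> size w < 2 * girth G -> uniq (map (@tail G) w).
Proof.
move=> cw; apply: contraLR => /repeat_split[p1 [x [p2 [y [p3 [wE exy]]]]]].
have: path.cycle nb_step ((x :: p2) ++ y :: (p3 ++ p1)).
  by move: cw; rewrite -(rot_cycle (size p1)) wE rot_size_cat /= -catA.
rewrite /= -cats1 -catA /= cat_path /= cat_path /=.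
case/and3P=> xp2 /andP[/eqP hy _] /and3P[yp /andP[/eqP hx _] _].
have g1 := nb_closed_walk_girth xp2; rewrite hy exy in g1.
have g2 := nb_closed_walk_girth yp; rewrite hx exy in g2.
rewrite -leqNgt wE !size_cat /= size_cat /=.
rewrite mul2n -addnn; apply: leq_trans (leq_add (g1 erefl) (g2 erefl)) _.
by rewrite size_cat addSn !addnS !ltnS addnA addnC.
Qed.

End NonBacktracking.

Local Open Scope ring_scope.

Lemma big_tuple_cons (R : Type) (idx : R) (op : Monoid.com_law idx)
    (T : finType) (n : nat) (F : n.+1.-tuple T -> R) :
  \big[op/idx]_(t : n.+1.-tuple T) F t
    = \big[op/idx]_(x : T) \big[op/idx]_(t : n.-tuple T) F [tuple of x :: t].
Proof.
pose cons_pair (p : T * n.-tuple T) := [tuple of p.1 :: p.2].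
rewrite pair_big /= (reindex cons_pair) //=.
exists (fun t => (thead t, [tuple of behead t])) => [[x t]|t] _ /=.
  by congr (_, _); apply: val_inj.
by rewrite [RHS]tuple_eta.
Qed.

Lemma big_ord_enum_val (R : Type) (idx : R) (op : Monoid.com_law idx)
    (T : finType) (F : T -> R) :
  \big[op/idx]_(i < #|T|) F (enum_val i) = \big[op/idx]_(x : T) F x.
Proof.
rewrite (reindex _ (onW_bij _ (enum_rank_bij T))).
by apply: eq_bigr => x _; rewrite enum_rankK.
Qed.

(** Powers of the 0/1 matrix of a relation count its paths. *)
Lemma expr_rel_mx (R : nzRingType) (T : finType) (e : rel T) (k : nat) i j :
  ((\matrix_(i < #|T|, j < #|T|) (e (enum_val i) (enum_val j))%:R : 'M[R]__)
     ^+ k) i j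
    = \sum_(p : k.-tuple T)
        (path e (enum_val i) p && (last (enum_val i) p == enum_val j))%:R.
Proof.
set M := (X in X ^+ k).
have ME a b : M a b = (e (enum_val a) (enum_val b))%:R by rewrite mxE.
elim: k i => [|k IHk] i.
  rewrite expr0 (big_pred1 [tuple]) => [|p]; last by rewrite [p]tuple0 /= eqxx.
  by rewrite /= mxE (inj_eq enum_val_inj).
rewrite exprS mxE big_tuple_cons.
under [LHS]eq_bigr => l _ do rewrite ME IHk mulr_sumr.
rewrite (big_ord_enum_val _ (fun x => \sum_(p : k.-tuple T)
  (e (enum_val i) x)%:R * (path e x p && (last x p == enum_val j))%:R)).
apply: eq_bigr => x _; apply: eq_bigr => p _ /=.
by rewrite -natrM mulnb andbA.
Qed.

Lemma trace_expr_rel_mx (R : nzRingType) (T : finType) (e : rel T) (k : nat) :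
    (0 < k)%N ->
  \tr ((\matrix_(i < #|T|, j < #|T|) (e (enum_val i) (enum_val j))%:R : 'M[R]__)
     ^+ k)
    = #|[set w : k.-tuple T | path.cycle e w]|%:R.
Proof.
case: k => // k _; rewrite /mxtrace.
under eq_bigr => i _ do rewrite expr_rel_mx.
rewrite (big_ord_enum_val _ (fun x => \sum_(p : k.+1.-tuple T)
  (path e x p && (last x p == x))%:R)) exchange_big /= -sum1_card natr_sum.
rewrite [RHS]big_mkcond; apply: eq_bigr => p _; rewrite inE.
case: (tupleP p) => x0 q; rewrite (cycle_path x0) /=.
rewrite (bigD1 (last x0 q)) //= eqxx andbT big1 ?addr0; first by case: ifP.
by move=> x /negPf lx; rewrite eq_sym lx andbF.
Qed.

Section NonBacktrackingTrace.
Variable G : sgraph.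

Lemma trace_nonbacktracking (k : nat) : (0 < k)%N ->
  \tr (nonbacktracking_mx G ^+ k)
    = #|[set w : k.-tuple (dart G) | path.cycle (@nb_step G) w]|%:R.
Proof. exact: trace_expr_rel_mx. Qed.

Lemma trace_nonbacktracking_lt_girth (k : nat) :
  (0 < k < girth G)%N -> \tr (nonbacktracking_mx G ^+ k) = 0.
Proof.
case/andP=> k0 kg; rewrite trace_nonbacktracking //.
rewrite (_ : [set _ | _] = set0) ?cards0 //.
apply/setP=> w; rewrite !inE; apply/negP; case: k k0 kg w => // k _ kg w.
case: (tupleP w) => d q; rewrite /path.cycle /= rcons_path.
case/andP=> dq /andP[/eqP hd _].
have := nb_closed_walk_girth dq (esym hd); rewrite size_tuple.
by rewrite leqNgt kg.
Qed.

Lemma cycle_nb_cycle (c : seq G) :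
    (2 < size c)%N -> uniq c -> path.cycle (@adj G) c ->
  exists w : (size c).-tuple (dart G), path.cycle (@nb_step G) w.
Proof.
move=> c2 Uc cyc.
have adj_next v : v \in c -> adj v (next c v) by exact: next_cycle.
have [v0 v0c] : exists v0, v0 \in c.
  by case: c c2 {Uc cyc adj_next} => // v0 c _; exists v0; rewrite mem_head.
pose d0 : dart G := Sub (v0, next c v0) (adj_next _ v0c).
pose f v : dart G := insubd d0 (v, next c v).
have tf : {in c, forall v, tail (f v) = v}.
  by move=> v vc; rewrite /tail val_insubd /= adj_next.
have hf : {in c, forall v, head (f v) = next c v}.
  by move=> v vc; rewrite /head val_insubd /= adj_next.
exists (map_tuple f (in_tuple c)); rewrite /= cycle_map.
apply: (cycle_from_next Uc) => v vc.
have nvc : next c v \in c by rewrite mem_next.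
rewrite /relpre /nb_step /= hf // tf // eqxx; apply/eqP => /(congr1 (@head G)).
rewrite hf // [RHS]tf // => eqv.
(* A cycle of length at least 3 does not return to [v] after two steps. *)
case/rot_to: vc => i q rotE.
move: eqv c2; rewrite -(size_rot i) -!(next_rot i Uc).
have := Uc; rewrite -(rot_uniq i) rotE.
case: q {rotE} => [|a [|b q]] //= /andP[]; rewrite !inE !negb_or eqxx.
case/and3P=> va vb _ _; rewrite eq_sym (negPf va) eqxx => eb.
by rewrite eb eqxx in vb.
Qed.

End NonBacktrackingTrace.

Local Open Scope nat_scope.

(** * The expected number of short faces *)

(** The rotations at different vertices are chosen independently. *)
Lemma card_rotation_systems (G : sgraph) (P : G -> pred {perm G}) :
  #|[set rho : rotation_system G | [forall v, P v (rot rho v)]]|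
    = \prod_v #|[set s | cyclic_ordering (neighbours v) s & P v s]|.
Proof.
rewrite -(card_imset _ val_inj).
pose F v : pred {perm G} :=
  [pred s | cyclic_ordering (neighbours v) s && P v s].
transitivity #|family F|.
  apply: eq_card => r; apply/imsetP/familyP => [[rho + ->] v|Fr].
    rewrite inE => /forallP/(_ v); rewrite !inE => ->; rewrite andbT.
    exact: (forallP (valP rho)).
  have r_cyc : [forall v, cyclic_ordering (neighbours v) (r v)].
    by apply/forallP=> v; case/andP: (Fr v).
  exists (Sub r r_cyc); rewrite ?SubK // inE; apply/forallP=> v.
  by rewrite /rot SubK; case/andP: (Fr v).
rewrite card_family foldrE big_map big_enum /=.
by apply: eq_bigr => v _; rewrite cardsE.
Qed.

(** A cycle of length k of s is the same as a closed walk along s without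
    repetition, based at any of its k points. *)
Lemma card_fcycles (T : finType) (s : {perm T}) (k : nat) : 0 < k ->
  #|[set x | #|porbit s x| == k]|
    = #|[set w : k.-tuple T | uniq w & fcycle s w]|.
Proof.
move=> k0.
have sz x : size (traject s x k) == k by rewrite size_traject.
pose f x : k.-tuple T := Tuple (sz x).
have f_inj : injective f.
  by move=> x y /(congr1 val) /=; case: {+}k k0 => //= m _ [].
rewrite -(card_imset _ f_inj); apply: eq_card => w; rewrite !inE.
apply/imsetP/andP => [[x + ->]|[Uw cw]].
  rewrite inE => /eqP kE; split; first by rewrite /= -kE uniq_traject_porbit.
  have := iter_porbit s x; rewrite kE /=; case: {+}k k0 => //= m _ eqx.
  rewrite rcons_path; apply/andP; split; first exact: fpath_traject.
  by rewrite /= last_traject eqx.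
case: w Uw cw => -[|x p] /= szp; first by rewrite -(eqP szp) in k0.
move=> Uw cw.
have /andP[fp /eqP lx] : fpath s x p && (s (last x p) == x).
  by rewrite -rcons_path.
have xpE : x :: p = traject s x k.
  by rewrite -(eqP szp) /= {1}(fpathE fp).
exists x; last by apply: val_inj; apply: xpE.
have lt_iter : s (last x p) = iter k s x.
  by rewrite -(eqP szp) (fpathE fp) last_traject size_traject.
rewrite inE; apply/eqP.
transitivity #|x :: p|; last first.
  by rewrite (card_uniqP (_ : uniq (x :: p))) /= ?(eqP szp).
apply: eq_card => y; apply/porbitP/idP => [[i ->]|]; last first.
  by rewrite xpE => /trajectP[i _ ->]; exists i; rewrite permX.
elim: i => [|i IHi]; first by rewrite perm1 mem_head.
rewrite expgSr permM; move: IHi; rewrite xpE => /trajectP[j lt_jk ->].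
rewrite -iterS; move: lt_jk; rewrite leq_eqVlt => /predU1P[->|lt_jk].
  by rewrite -lt_iter lx -xpE mem_head.
by apply/trajectP; exists j.+1.
Qed.

Lemma uniq_map_in_inj (T S : eqType) (f : T -> S) (s : seq T) :
  uniq (map f s) -> {in s &, injective f}.
Proof.
elim: s => //= x s IHs /andP[fx /IHs inj] y z.
rewrite !inE => /predU1P[->|ys] /predU1P[->|zs] // e; last exact: inj.
  by rewrite e map_f in fx.
by rewrite -e map_f in fx.
Qed.

Section CubicFaces.
Variable G : sgraph.
Hypothesis G3 : cubic G.

Lemma card_cubic_rotations : #|rotation_system G| = 2 ^ #|G|.
Proof.
have := card_rotation_systems (fun _ : G => predT).
rewrite (_ : [set rho | _] = setT) => [|]; last first.
  by apply/setP=> rho; rewrite !inE; apply/forallP.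
rewrite cardsT => ->; rewrite (eq_bigr (fun=> 2)) => [|v _].
  by rewrite prod_nat_const.
rewrite -(card_cyclic_ordering (G3 v)); apply: eq_card => s.
by rewrite !inE andbT.
Qed.

(** Otherwise the rotation at the head of d would fix the tail of d, while it is
    a single cycle on three neighbours. *)
Lemma face_fun_nb_step (rho : rotation_system G) d : nb_step d (face_fun rho d).
Proof.
rewrite /nb_step /tail /= eqxx; apply/eqP=> /(congr1 (@head G)).
rewrite /head /= -/(head d) -/(tail d).
set s := rot rho (head d); set u := tail d => sv.
have /andP[_ /forallP/(_ u)] := forallP (valP rho) (head d).
rewrite inE (dart_rev_subproof d) /= -/s => /eqP orb.
have := G3 (head d); rewrite -orb (_ : porbit s u = [set u]) ?cards1 //.
apply/setP=> w; rewrite inE; apply/porbitP/eqP => [[i ->]|->]; last first.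
  by exists 0; rewrite perm1.
by elim: i => [|i IHi]; rewrite ?perm1 // expgSr permM IHi.
Qed.

(** The walk is a face exactly when, at the head of each of its darts d, the
    rotation sends the tail of d to the head of the next dart.  This leaves one
    of the two cyclic orderings at each vertex of the walk, and both of them
    elsewhere. *)
Lemma card_rotations_face (w : seq (dart G)) :
    path.cycle (@nb_step G) w -> uniq (map (@tail G) w) ->
  #|[set rho : rotation_system G | fcycle (face_perm rho) w]| * 2 ^ size w
    = 2 ^ #|G|.
Proof.
move=> cw Ut.
have Uw : uniq w := map_uniq Ut.
have stepw d : d \in w -> nb_step d (next w d) by exact: next_cycle.
pose P v : pred {perm G} := fun s =>
  all (fun d => (head d == v) ==> (s (tail d) == head (next w d))) w.
have -> : [set rho : rotation_system G | fcycle (face_perm rho) w]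
            = [set rho | [forall v, P v (rot rho v)]].
  apply/setP=> rho; rewrite !inE; apply/idP/forallP => [fw v|Prho].
    apply/allP=> d dw; apply/implyP=> /eqP<-.
    by have /eqP<- := next_cycle fw dw; rewrite permE.
  apply: (cycle_from_next Uw) => d dw; apply/eqP.
  have /allP/(_ d dw) := Prho (head d); rewrite eqxx /= => /eqP sd.
  apply: dart_eq; rewrite permE /=.
    by case/andP: (stepw d dw) => /eqP.
  by rewrite -sd.
rewrite card_rotation_systems.
have heads v : (v \in map (@head G) w) = (v \in map (@tail G) w).
  have /eq_mem_map : w =i map (next w) w.
    move=> d; apply/idP/mapP => [dw|[e ew ->]]; last by rewrite mem_next.
    by exists (prev w d); rewrite ?mem_prev // next_prev.
  move/(_ _ (@tail G)) => ->; rewrite -map_comp; congr (_ \in _).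
  by apply/eq_in_map=> d dw; case/andP: (stepw d dw) => /eqP.
pose A := [set v in map (@tail G) w].
have cA : #|A| = size w.
  by rewrite cardsE (card_uniqP Ut) size_map.
have tail_inj := uniq_map_in_inj Ut.
rewrite (bigID (mem A)) /= big1 => [|v]; last first.
  rewrite inE -heads => /mapP[d dw vE]; rewrite vE.
  have nw e : e \in w -> next w e \in w by rewrite mem_next.
  have /andP[/eqP hd nd] := stepw d dw.
  have hu e : e \in w -> head e = head d -> e = d.
    move=> ew; have /andP[/eqP-> _] := stepw e ew; rewrite hd => /tail_inj.
    move=> /(_ (nw e ew) (nw d dw)) /(congr1 (prev w)).
    by rewrite !prev_next.
  rewrite (_ : [set s | _ & _]
    = [set s | cyclic_ordering (neighbours (head d)) s
             & s (tail d) == head (next w d)]).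
    apply: card_cyclic_ordering_succ; first exact: G3.
    - by rewrite inE adj_sym adj_dart.
    - by rewrite inE hd adj_dart.
    - apply: contraNneq nd => e; apply/eqP/dart_eq; first by rewrite -hd.
      by rewrite -e.
  apply/setP=> s; rewrite !inE; congr (_ && _).
  apply/allP/idP => [/(_ d dw)|sd e ew]; first by rewrite eqxx.
  by apply/implyP=> /eqP /(hu e ew) ->.
rewrite mul1n (eq_bigr (fun=> 2)) => [|v vA]; last first.
  rewrite -(card_cyclic_ordering (G3 v)); apply: eq_card => s; rewrite !inE.
  case: (cyclic_ordering _ s) => //=; apply/allP=> d dw; apply/implyP=> /eqP hd.
  by move: vA; rewrite inE -heads -hd map_f.
rewrite (eq_bigl (mem (~: A))) => [|v]; last by rewrite !inE.
by rewrite prod_nat_const -cA -expnD addnC cardsC.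
Qed.
(** Double counting of the pairs of a rotation system and a based face of length
    k: every closed non-backtracking walk of length k < 2 l is a face of
    2^(n - k) rotation systems. *)
Lemma sum_short_faces_length (k : nat) : 0 < k < 2 * girth G ->
  (\sum_(rho : rotation_system G) #|[set d | #|porbit (face_perm rho) d| == k]|)
      * 2 ^ k
    = #|[set w : k.-tuple (dart G) | path.cycle (@nb_step G) w]| * 2 ^ #|G|.
Proof.
case/andP=> k0 kg.
under eq_bigr => rho _ do rewrite card_fcycles // -sum1dep_card.
rewrite (exchange_big_dep predT) //= -sum1dep_card !big_distrl /=.
rewrite [RHS]big_mkcond /=.
apply: eq_bigr => w _; rewrite sum1dep_card mul1n; case: ifPn => [cw|ncw].
  have Ut : uniq (map (@tail G) w) by rewrite nb_cycle_uniq_tails ?size_tuple.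
  rewrite -(card_rotations_face cw Ut) size_tuple; congr (_ * _).
  by apply: eq_card => rho; rewrite !inE (map_uniq Ut).
rewrite (_ : [set _ | _] = set0) ?cards0 //; apply/setP=> rho; rewrite !inE.
apply: contraNF ncw => /andP[_]; apply: sub_cycle => d e /eqP<-.
by rewrite permE face_fun_nb_step.
Qed.

End CubicFaces.

Local Open Scope ring_scope.

(** A cycle of length k is counted by each of its k points with weight 1 / k. *)
Lemma card_porbits_lt (T : finType) (s : {perm T}) (t : nat) :
  #|[set f in porbits s | #|f| < t]%N|%:R
    = \sum_(1 <= k < t) #|[set x | #|porbit s x| == k]%N|%:R / k%:R :> rat.
Proof.
have -> : #|[set f in porbits s | #|f| < t]%N|%:R
    = \sum_(x | (#|porbit s x| < t)%N) #|porbit s x|%:R^-1 :> rat.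
  rewrite (partition_big (porbit s) (mem [set f in porbits s | #|f| < t]%N)) /=.
    2: by move=> x xt; rewrite inE imset_f.
  rewrite -sum1_card natr_sum; apply: eq_bigr => f; rewrite inE.
  case/andP=> /imsetP[x _ ->] lt_t.
  rewrite (eq_big (mem (porbit s x)) (fun=> #|porbit s x|%:R^-1)); first last.
  - by move=> y /andP[_ /eqP->].
  - move=> y /=; rewrite -eq_porbit_mem.
    by case: eqP => [->|]; rewrite ?lt_t ?andbF.
  by rewrite sumr_const -[RHS]mulr_natr mulVf // pnatr_eq0 card_porbit_neq0.
rewrite big_mkcond.
rewrite (eq_bigr (fun x =>
  \sum_(1 <= k < t) (#|porbit s x| == k)%N%:R / k%:R)).
  rewrite exchange_big /=; apply: eq_bigr => k _.
  by rewrite -mulr_suml -natr_sum -sum1dep_card [in RHS]big_mkcond.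
move=> x _; have [lt_t|le_t] := ltnP.
  rewrite (bigD1_seq #|porbit s x|%N) ?iota_uniq //=; last first.
    by rewrite mem_index_iota lt_t lt0n card_porbit_neq0.
  rewrite eqxx mul1r big1 ?addr0 // => k /negPf nk.
  by rewrite eq_sym nk mul0r.
rewrite big_nat big1 // => k /andP[_ lt_kt].
by rewrite gtn_eqF ?mul0r // (leq_trans lt_kt).
Qed.

Lemma short_faces_trace (G : sgraph) : cubic G ->
  short_faces G =
  \sum_(girth G <= k < 2 * girth G)
    \tr (nonbacktracking_mx G ^+ k) / (k%:R * 2%:R ^+ k).
Proof.
move=> G3; rewrite /short_faces /expectation /num_faces_lt.
under eq_bigr => rho _ do rewrite card_porbits_lt.
rewrite exchange_big /= mulr_suml card_cubic_rotations //.
have cross_mul (s c a b q : rat) : a != 0 -> b != 0 -> q != 0 ->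
    s * a = c * b -> s / q / b = c / (q * a).
  move=> a0 b0 q0 e; have -> : s = c * b / a by rewrite -e mulfK.
  by field; rewrite ?a0 ?b0 ?q0.
have term k : (1 <= k < 2 * girth G)%N ->
    (\sum_(rho : rotation_system G)
        #|[set x | #|porbit (face_perm rho) x| == k]%N|%:R / k%:R)
      / (2 ^ #|G|)%N%:R
    = \tr (nonbacktracking_mx G ^+ k) / (k%:R * 2%:R ^+ k) :> rat.
  move=> k_range; have := sum_short_faces_length G3 k_range.
  case/andP: k_range => k0 _; rewrite trace_nonbacktracking //.
  move/(congr1 (fun m => m%:R : rat)).
  rewrite !natrM natr_sum !natrX -mulr_suml => e.
  have two_neq0 m : 2%:R ^+ m != 0 :> rat by rewrite expf_neq0.
  have k_neq0 : k%:R != 0 :> rat by rewrite pnatr_eq0 -lt0n.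
  exact: cross_mul.
rewrite (eq_big_nat _ _ term).
have [->|g0] := posnP (girth G); first by rewrite !big_geq.
rewrite (big_cat_nat (n := girth G)) //=; last by rewrite leq_pmull.
rewrite big_nat big1 ?add0r // => k k_range.
by rewrite trace_nonbacktracking_lt_girth // mul0r.
Qed.

(** * Traces of powers of the non-backtracking matrix *)

Section TracePowers.
Variables (R : comNzRingType) (m n : nat).
Variables (S : 'M[R]_(m, n)) (T : 'M[R]_(n, m)) (P : 'M[R]_m) (A : 'M[R]_n).

(** For A' = A these are the matrices ((U S, V S), (U P S, V P S)), where
    (S T - P)^k = S U + P S V + (-P)^k. *)
Fixpoint nb_coef (n' : nat) (A' : 'M[R]_n') (k : nat) :
    ('M[R]_n' * 'M[R]_n') * ('M[R]_n' * 'M[R]_n') :=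
  if k is k'.+1 then
    let: ((a, b), (c, d)) := nb_coef A' k' in
    ((A' *m a + b *+ 2 + (if odd k' then - 3%:M else A'), - a),
     (A' *m c + d *+ 2 + (if odd k' then - A' else 3%:M), - c))
  else ((0, 0), (0, 0)).

Hypotheses (TS : T *m S = A) (PP : P *m P = 1%:M) (TPS : T *m P *m S = 3%:M).
Hypothesis trP : \tr P = 0.

(** The columns of S and P S span a space that is stable under S T - P, because
    (S T - P) S = S A - P S and (S T - P) P S = 2 S; the remaining part of the
    k-th power is (-P)^k, which is 1 or -P. *)
Lemma trace_nb_power (k : nat) :
  \tr ((S *m T - P) ^+ k)
    = \tr (nb_coef A k).1.1 + \tr (nb_coef A k).2.2
      + (if odd k then 0 else m%:R).
Proof.
pose E k := if odd k then - P else 1%:M : 'M[R]_m.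
suff: exists U V : 'M[R]_(n, m),
    (S *m T - P) ^+ k = S *m U + P *m S *m V + E k /\
    nb_coef A k = ((U *m S, V *m S), (U *m P *m S, V *m P *m S)).
  case=> U [V [-> ->]]; rewrite /= !linearD /=.
  rewrite [in X in _ + X + _]mxtrace_mulC.
  rewrite [\tr (S *m U)]mxtrace_mulC mulmxA /E; congr (_ + _).
  by case: ifP => _; rewrite ?linearN /= ?trP ?oppr0 // mxtrace1.
elim: k => [|k [U [V [IHk coefk]]]].
  exists 0, 0; split=> //; last by rewrite /= !mul0mx.
  by rewrite expr0 !mulmx0 !add0r.
exists (A *m U + V *+ 2 + (if odd k then - (T *m P) else T)), (- U); split=> //.
  rewrite exprS IHk [LHS]mulmxDr mulmxDr /E /=.
  have -> : (S *m T - P) *m (S *m U) = S *m (A *m U) - P *m S *m U.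
    by rewrite mulmxBl !mulmxA -(mulmxA S T S) TS -!mulmxA.
  have -> : (S *m T - P) *m (P *m S *m V) = S *m (V *+ 2).
    rewrite mulmxBl !mulmxA PP mul1mx -!(mulmxA S) -!mulmxA (mulmxA P).
    rewrite (mulmxA T) (mulmxA T) TPS mul_scalar_mx -mulmxBr; congr (S *m _).
    rewrite -[X in _ - X]scale1r -scalerBl -scaler_nat; congr (_ *: _).
    by rewrite -[X in _ - X]/(1%:R) -natrB.
  rewrite mulmxN !mulmxDr; case: (odd k) => /=.
    rewrite mulmxN mulmxBl -mulmxA PP opprB mulmxN.
    by rewrite !mulmxA !addrA [LHS](ACl (1*3*4*6*2*5)).
  by rewrite mulmx1 !addrA [LHS](ACl (1*3*4*5*2*6)).
rewrite /= coefk !mulr2n !mulmxDl !mulNmx -!mulmxA.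
have TPPS : T *m (P *m (P *m S)) = A by rewrite (mulmxA P P) PP mul1mx.
have TPS' : T *m (P *m S) = 3%:M by rewrite mulmxA.
by case: (odd k); rewrite ?mulNmx -?mulmxA ?TPPS ?TPS' ?TS.
Qed.
End TracePowers.

Lemma nb_coef_intertwine (R : comNzRingType) (n : nat) (A A' Q : 'M[R]_n) k :
    A *m Q = Q *m A' ->
  [/\ (nb_coef A k).1.1 *m Q = Q *m (nb_coef A' k).1.1,
      (nb_coef A k).1.2 *m Q = Q *m (nb_coef A' k).1.2,
      (nb_coef A k).2.1 *m Q = Q *m (nb_coef A' k).2.1
    & (nb_coef A k).2.2 *m Q = Q *m (nb_coef A' k).2.2].
Proof.
move=> AQ; elim: k => [|k /=]; first by rewrite /= !mul0mx !mulmx0.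
case: (nb_coef A k) => [[a b] [c d]].
case: (nb_coef A' k) => [[a' b'] [c' d']] /= [].
move=> aQ bQ cQ dQ; split; rewrite ?mulNmx ?mulmxN ?aQ ?cQ //.
  rewrite !mulr2n !(mulmxDl, mulmxDr) bQ -mulmxA aQ !mulmxA AQ; congr (_ + _).
  by case: ifP; rewrite // mulNmx mulmxN scalar_mxC.
rewrite !mulr2n !(mulmxDl, mulmxDr) dQ -mulmxA cQ !mulmxA AQ; congr (_ + _).
by case: ifP; rewrite ?mulNmx ?mulmxN ?AQ // scalar_mxC.
Qed.

Lemma mxtrace_intertwine (R : comUnitRingType) (n : nat) (A A' Q : 'M[R]_n) :
  Q \in unitmx -> A *m Q = Q *m A' -> \tr A = \tr A'.
Proof.
move=> Qu AQ; rewrite -[A in LHS](mulmxK Qu) AQ.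
by rewrite mxtrace_mulC mulKmx.
Qed.

Lemma char_poly_intertwine (R : idomainType) (n : nat) (A A' Q : 'M[R]_n) :
  \det Q != 0 -> A *m Q = Q *m A' -> char_poly A = char_poly A'.
Proof.
move=> Qu AQ; have QX : map_mx polyC Q = map_mx polyC Q by [].
have : char_poly_mx A *m map_mx polyC Q = map_mx polyC Q *m char_poly_mx A'.
  by rewrite mulmxBl mulmxBr -!map_mxM AQ scalar_mxC.
move/(congr1 determinant); rewrite !det_mulmx mulrC; apply: mulfI.
by rewrite det_map_mx polyC_eq0.
Qed.

(** Both matrices are conjugate to the diagonal matrix of their eigenvalues, and
    the two diagonals agree up to a permutation. *)
Lemma normal_similar (C : numClosedFieldType) (n : nat) (A A' : 'M[C]_n) :
    A \is normalmx -> A' \is normalmx -> char_poly A = char_poly A' ->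
  exists2 Q, Q \in unitmx & A *m Q = Q *m A'.
Proof.
move=> /orthomx_spectralP AE /orthomx_spectralP A'E eqp.
have charE (B : 'M[C]_n) (d := spectral_diag B) (U := spectralmx B) :
    B = invmx U *m diag_mx d *m U ->
    char_poly B = \prod_(x <- [seq d 0 i | i <- enum 'I_n]) ('X - x%:P).
  move=> BE; rewrite big_map big_enum /=.
  rewrite (@char_poly_intertwine _ _ B (diag_mx d) (invmx U)).
  - rewrite char_poly_trig ?diag_mx_is_trig //.
    by apply: eq_bigr => i _; rewrite mxE eqxx.
  - by rewrite -unitfE -[_ \is a _]/(_ \in unitmx) unitmx_inv spectral_unit.
  - by rewrite {1}BE mulmxK ?spectral_unit.
move: eqp; rewrite (charE _ AE) (charE _ A'E) => /prod_XsubC_eq.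
pose t B : n.-tuple C := [tuple spectral_diag B 0 i | i < n].
move/(@tuple_permP _ _ _ (t A')) => [p pE].
have dE i : spectral_diag A 0 i = spectral_diag A' 0 (p i).
  have := congr1 (fun s => nth 0 s i) pE.
  rewrite (nth_map i) ?size_enum_ord // nth_ord_enum => ->.
  by rewrite -tnth_nth tnth_mktuple tnth_mktuple.
exists (invmx (spectralmx A) *m perm_mx p *m spectralmx A').
  by rewrite !unitmx_mul unitmx_inv unitmx_perm !spectral_unit.
rewrite {1}AE {3}A'E !mulmxA !mulmxK ?spectral_unit //.
congr (_ *m _); rewrite -!mulmxA; congr (_ *m _).
apply/matrixP=> i j; rewrite mul_diag_mx mul_mx_diag !mxE dE.
by case: eqP => [->|_]; rewrite ?mulr1 ?mul1r ?mulr0 ?mul0r.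
Qed.

(** * Cospectral cubic graphs have the same short-face contribution *)

Lemma char_poly_spectrum (n : nat) (A : 'M[algC]_n) :
  char_poly A = \prod_(x <- spectrum A) ('X - x%:P).
Proof.
rewrite /spectrum; case: closed_field_poly_normal => r /= ->.
by rewrite (monicP (char_poly_monic A)) scale1r.
Qed.

Lemma cospectralP (G H : sgraph) :
  reflect (char_poly (adjacency_mx G) = char_poly (adjacency_mx H))
    (cospectral G H).
Proof.
apply: (iffP idP) => [GH|GH]; last by rewrite /cospectral /spectrum GH.
by rewrite !char_poly_spectrum; apply: perm_big.
Qed.

Lemma adjacency_normal (G : sgraph) : adjacency_mx G \is normalmx.
Proof.
apply: symmetric_normalmx.
  apply/is_hermitianmxP; rewrite expr0 scale1r.
  by apply/matrixP=> i j; rewrite !mxE adj_sym.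
by apply/mxOverP => i j; rewrite mxE realn.
Qed.

Section CubicTrace.
Variable G : sgraph.
Hypothesis G3 : cubic G.

Lemma card_cubic_darts : #|dart G| = (3 * #|G|)%N.
Proof.
rewrite card_sub -sum1_card.
rewrite (eq_bigl (fun p : G * G => adj p.1 p.2)) //.
rewrite -(pair_big_dep predT (@adj G) (fun _ _ => 1%N)) /=.
rewrite (eq_bigr (fun=> 3)) => [|v _]; last by rewrite sum1dep_card; apply: G3.
by rewrite sum_nat_const mulnC.
Qed.

Definition rel_mx (T1 T2 : finType) (e : T1 -> T2 -> bool) :
    'M[algC]_(#|T1|, #|T2|) :=
  \matrix_(i, j) (e (enum_val i) (enum_val j))%:R.

Lemma mul_rel_mx (T1 T2 T3 : finType) (e : T1 -> T2 -> bool)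
    (f : T2 -> T3 -> bool) i j :
  (rel_mx e *m rel_mx f) i j
    = #|[set x | e (enum_val i) x & f x (enum_val j)]|%:R.
Proof.
rewrite mxE -sum1dep_card natr_sum [RHS]big_mkcond /= -[RHS]big_ord_enum_val.
by apply: eq_bigr => l _; rewrite !mxE -natrM mulnb; case: ifP.
Qed.

Let S := rel_mx (fun (d : dart G) v => head d == v).
Let T := rel_mx (fun v (d : dart G) => v == tail d).
Let P := rel_mx (fun d e : dart G => e == dart_rev d).

Lemma dart_revK : involutive (@dart_rev G).
Proof. by move=> d; apply: dart_eq. Qed.

(** Applies [trace_nb_power] to the incidence matrices of heads and tails and to
    the reversal of darts; T P S = 3 says that G is cubic. *)
Lemma trace_nb_adjacency (k : nat) : (0 < k)%N ->
  #|[set w : k.-tuple (dart G) | path.cycle (@nb_step G) w]|%:R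
    = \tr (nb_coef (adjacency_mx G) k).1.1
      + \tr (nb_coef (adjacency_mx G) k).2.2
      + (if odd k then 0 else (3 * #|G|)%:R).
Proof.
move=> k0; rewrite -(trace_expr_rel_mx algC _ k0) -card_cubic_darts.
have cards_if (b : bool) (X : finType) (x : X) (p : pred X) :
    (forall y, p y = b && (y == x)) -> #|[set y | p y]|%:R = b%:R :> algC.
  move=> pE; case: b pE => pE; last first.
    rewrite (_ : [set y | p y] = set0) ?cards0 //.
    by apply/setP=> y; rewrite !inE pE.
  rewrite (_ : [set y | p y] = [set x]) ?cards1 //.
  by apply/setP=> y; rewrite !inE pE.
have BE : \matrix_(i, j) (nb_step (enum_val i) (enum_val j))%:R = S *m T - P.
  apply/matrixP=> i j; rewrite [RHS]mxE mul_rel_mx !mxE.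
  set d := enum_val i; set e := enum_val j.
  rewrite (cards_if (head d == tail e) _ (tail e)) => [|v]; last first.
    by rewrite andbC; case: eqP => [->|]; rewrite ?andbF ?andbT // eq_sym.
  rewrite /nb_step; have [->|_] := eqVneq e (dart_rev d).
    by rewrite /= eqxx subrr andbF.
  by rewrite subr0 andbT.
have TS : T *m S = adjacency_mx G.
  apply/matrixP=> i j; rewrite mul_rel_mx mxE.
  set u := enum_val i; set v := enum_val j.
  have [uv|nuv] := boolP (adj u v).
    rewrite (cards_if true _ (Sub (u, v) uv : dart G)) // => d.
    apply/andP/eqP => [[/eqP tu /eqP hv]|->]; first exact: dart_eq.
    by rewrite /tail /head /=.
  rewrite (_ : [set _ | _ & _] = set0) ?cards0 //; apply/setP=> d; rewrite !inE.
  by apply: contraNF nuv => /andP[/eqP-> /eqP<-]; apply: adj_dart.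
have PP : P *m P = 1%:M.
  apply/matrixP=> i j; rewrite mul_rel_mx mxE -(inj_eq enum_val_inj).
  apply: (cards_if _ _ (dart_rev (enum_val i))) => d.
  have [->|_] := eqVneq d (dart_rev _); rewrite ?andbF //.
  by rewrite dart_revK eq_sym andbT.
have TP : T *m P = rel_mx (fun v (d : dart G) => v == head d).
  apply/matrixP=> i j; rewrite mul_rel_mx mxE.
  apply: (cards_if _ _ (dart_rev (enum_val j))) => d.
  rewrite -(can_eq dart_revK (enum_val j)) dart_revK [_ == d]eq_sym.
  by have [->|_] := eqVneq d (dart_rev _); rewrite ?andbF // andbT.
have TPS : T *m P *m S = 3%:M.
  apply/matrixP=> i j; rewrite TP mul_rel_mx mxE -(inj_eq enum_val_inj).
  set u := enum_val i; set v := enum_val j.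
  have [<-|/negPf nuv] := eqVneq u v; last first.
    rewrite (_ : [set _ | _ & _] = set0) ?cards0 //.
    apply/setP=> d; rewrite !inE.
    by apply: contraFF nuv => /andP[/eqP-> /eqP->].
  have tail_inj : {in [set d : dart G | u == head d & head d == u] &,
      injective (@tail G)}.
    move=> d e; rewrite !inE => /andP[/eqP ud _] /andP[/eqP ue _] tde.
    by apply: dart_eq; rewrite // -ud.
  rewrite -(G3 u) -(card_in_imset tail_inj) mulr1n; congr _%:R.
  apply: eq_card => w; rewrite inE; apply/imsetP/idP => [[d + ->]|uw].
    by rewrite inE => /andP[/eqP-> _]; rewrite adj_sym adj_dart.
  have wu : adj w u by rewrite adj_sym.
  by exists (Sub (w, u) wu : dart G); rewrite ?inE /tail /head /= ?eqxx.
rewrite BE (trace_nb_power TS PP TPS) //.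
rewrite /mxtrace big1 // => i _; rewrite mxE.
case: eqP => // /(congr1 (@tail G)).
by move/eqP; rewrite (negPf (tail_neq_head _)).
Qed.
(** The faces of any rotation system are closed non-backtracking walks, hence
    contain cycles. *)
Lemma cubic_cycle : (0 < #|G|)%N -> has_cycle_of_length G (girth G).
Proof.
move=> G0; suff gG : (girth G <= #|G|)%N.
  have := nth_find 0%N (s := iota 0 #|G|.+1) (a := has_cycle_of_length G).
  rewrite has_find size_iota -/(girth G) ltnS gG => /(_ isT).
  by rewrite nth_iota ?ltnS.
have [rho _] : exists rho, rho \in [set: rotation_system G].
  by apply/set0Pn; rewrite -card_gt0 cardsT card_cubic_rotations // expn_gt0.
have /card_gt0P[d _] : (0 < #|dart G|)%N by rewrite card_cubic_darts muln_gt0.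
have d_gt0 : (0 < #|porbit (face_perm rho) d|)%N.
  by rewrite lt0n card_porbit_neq0.
have := iter_porbit (face_perm rho) d; case: #|_| d_gt0 => // k _ closed.
have dp : fpath (face_perm rho) d (traject (face_perm rho) (face_perm rho d) k).
  exact: fpath_traject.
have faceE e : face_perm rho e = face_fun rho e by rewrite permE.
have [||m _ cyc_m] := @nb_closed_walk_cycle G d
    (traject (face_perm rho) (face_perm rho d) k).
- by apply: sub_path dp => e f /eqP<-; rewrite faceE face_fun_nb_step.
- by rewrite last_traject -[in LHS]closed /= faceE.
exact: leq_trans (girth_le cyc_m) (cycle_length_le cyc_m).
Qed.

Lemma trace_girth_neq0 :
  (0 < #|G|)%N -> \tr (nonbacktracking_mx G ^+ girth G) != 0.
Proof.
move/cubic_cycle=> /andP[g2 /existsP[c /andP[Uc cyc]]].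
rewrite trace_nonbacktracking; last exact: ltn_trans g2.
have [|w cw] := cycle_nb_cycle _ Uc cyc; first by rewrite size_tuple.
rewrite pnatr_eq0 -lt0n; move: w cw; rewrite size_tuple => w cw.
by apply/card_gt0P; exists w; rewrite inE.
Qed.

End CubicTrace.

Lemma cospectral_card (G H : sgraph) : cospectral G H -> #|G| = #|H|.
Proof.
move/cospectralP/(congr1 (fun p : {poly algC} => size p)).
by rewrite !size_char_poly => -[].
Qed.

Lemma cospectral_trace (G H : sgraph) (k : nat) :
    cubic G -> cubic H -> cospectral G H -> (0 < k)%N ->
  \tr (nonbacktracking_mx G ^+ k) = \tr (nonbacktracking_mx H ^+ k).
Proof.
move=> G3 H3 GH k0; rewrite !trace_nonbacktracking //.
suff: forall a b : nat, a%:R = b%:R :> algC -> a%:R = b%:R :> rat.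
  apply; rewrite !trace_nb_adjacency //.
  congr (_ + _); last by rewrite (cospectral_card GH).
  have trace_eq n n' (A : 'M[algC]_n) (A' : 'M[algC]_n') :
      n = n' -> A \is normalmx -> A' \is normalmx ->
      char_poly A = char_poly A' ->
      \tr (nb_coef A k).1.1 + \tr (nb_coef A k).2.2
        = \tr (nb_coef A' k).1.1 + \tr (nb_coef A' k).2.2.
    move=> nn'; case: n' / nn' A' => A' An A'n eqp.
    have [Q Qu AQ] := normal_similar An A'n eqp.
    have [aQ _ _ dQ] := nb_coef_intertwine k AQ.
    by rewrite (mxtrace_intertwine Qu aQ) (mxtrace_intertwine Qu dQ).
  apply: trace_eq; [exact: cospectral_card | exact: adjacency_normal
    | exact: adjacency_normal | exact/cospectralP].
by move=> a b /eqP; rewrite eqr_nat => /eqP->.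
Qed.

(** The girth is the least positive k for which tr(B^k) does not vanish. *)
Lemma cospectral_girth_le (G H : sgraph) :
    cubic G -> cubic H -> (0 < #|G|)%N -> cospectral G H ->
  (girth H <= girth G)%N.
Proof.
move=> G3 H3 G0 GH; rewrite leqNgt; apply/negP=> lt_g.
have g0 : (0 < girth G)%N.
  by have /andP[g2 _] := cubic_cycle G3 G0; apply: ltn_trans g2.
have := trace_girth_neq0 G3 G0; rewrite (cospectral_trace G3 H3 GH g0).
by rewrite trace_nonbacktracking_lt_girth ?eqxx // g0.
Qed.

Lemma cospectral_short_faces (G H : sgraph) :
    connected G -> cubic G -> connected H -> cubic H -> cospectral G H ->
  short_faces G = short_faces H.
Proof.
move=> [G0 _] G3 [H0 _] H3 GH.
have HG : cospectral H G by rewrite /cospectral perm_sym.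
have gGH : girth G = girth H.
  by apply/eqP; rewrite eqn_leq !cospectral_girth_le.
rewrite !short_faces_trace // gGH; apply: eq_big_nat => k /andP[gk _].
rewrite (cospectral_trace G3 H3 GH) //; apply: leq_trans gk.
by have /andP[g2 _] := cubic_cycle H3 H0; apply: ltn_trans g2.
Qed.

Local Open Scope nat_scope.

(** * Counting faces by joining path fragments *)

(** A pair (a, c) stands for an open path fragment that ends at the dart coded a
    and begins at the dart coded c.  A dart that is not listed as an end, and
    whose outgoing arc has not been added yet, is the end of the fragment that
    begins at itself, so that the empty list is the initial state. *)
Definition fragments := seq (N * N).

(** Adds the arc from a to b.  If the fragment ending at a begins at b, a face
    is closed, and the boolean is true.  Otherwise that fragment is prefixed to
    the fragment beginning at b, which may be the implicit fragment b alone. *)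

Definition add_arc (st : fragments) (ab : N * N) : fragments * bool :=
  let: (a, b) := ab in
  let c := seq.head a [seq p.2 | p <- st & p.1 == a] in
  let st' := [seq p <- st | p.1 != a] in
  if c == b then (st', true)
  else if has (fun p => p.2 == b) st'
  then ([seq if p.2 == b then (p.1, c) else p | p <- st'], false)
  else ((b, c) :: st', false).

Fixpoint add_arcs (st : fragments) (L : seq (N * N)) : fragments * nat :=
  if L is ab :: L' then
    let: (st1, closed) := add_arc st ab in
    let: (st2, k) := add_arcs st1 L' in (st2, closed + k)
  else (st, 0).

Section FaceTracing.
Variables (D : finType) (code : D -> N) (phi : {perm D}).
Hypothesis code_inj : injective code.

Lemma porbits1 : #|porbits (1 : {perm D})%g| = #|D|.
Proof.
rewrite /porbits card_imset // => x y /setP/(_ x); rewrite porbit_id.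
by move/esym/porbitP=> [i ->]; rewrite expg1n perm1.
Qed.

(** L lists the darts whose arcs are still to be added.  The permutation s
    consists of the arcs added so far, and closes every open fragment up by
    sending its end to its beginning; kappa is constant on the cycles of s, and
    its injectivity on L says that a cycle contains at most one open fragment.
    Joining two fragments multiplies s by a transposition of points of different
    cycles, which merges these cycles; closing a fragment leaves s as it is. *)
Lemma add_arcs_porbits (L : seq D) (s : {perm D}) (st : fragments)
    (kappa : D -> D) :
    uniq L ->
    (forall a, a \notin L -> s a = phi a) ->
    (forall p, p \in st -> exists2 a, a \in L & p = (code a, code (s a))) ->
    (forall a, a \in L -> (code a, code (s a)) \in st \/ s a = a) ->
    (forall a, kappa (s a) = kappa a) ->
    {in L &, injective kappa} ->
  #|porbits phi| + size L
    = #|porbits s| + (add_arcs st [seq (code a, code (phi a)) | a <- L]).2.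
Proof.
elim: L s st kappa => [|a L IHL] s st kappa /=.
  move=> _ s_phi _ _ _ _; rewrite !addn0; congr #|porbits _|.
  by apply/permP=> x; rewrite s_phi.
case/andP=> aL UL s_phi st_sound st_full kappa_s kappa_inj.
have aaL : a \in a :: L by rewrite mem_head.
have sub x : x \in L -> x \in a :: L by rewrite inE orbC => ->.
have -> : seq.head (code a) [seq p.2 | p <- st & p.1 == code a] = code (s a).
  have [no_a|] := boolP (has (fun p => p.1 == code a) st); last first.
    rewrite has_filter negbK => /eqP fE; rewrite fE /=.
    case: (st_full a aaL) => [|-> //] in_st.
    by have : (code a, code (s a)) \in [::] by rewrite -fE mem_filter eqxx.
  have : all (fun c => c == code (s a)) [seq p.2 | p <- st & p.1 == code a].
    apply/allP=> c /mapP[p]; rewrite mem_filter.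
    case/andP=> /eqP pa /st_sound[x _ pE] ->.
    by move: pa; rewrite pE => /code_inj->.
  move: no_a; rewrite has_filter.
  by case: (filter _ _) => //= p q _ /andP[/eqP-> _].
set b := phi a; set st' := [seq p <- st | p.1 != code a].
have st'_sound p : p \in st' -> exists2 x, x \in L & p = (code x, code (s x)).
  rewrite mem_filter => /andP[pa /st_sound[x xL pE]]; exists x => //.
  by move: xL pa; rewrite inE pE => /predU1P[->|//]; rewrite eqxx.
have st'_full x : x \in L -> (code x, code (s x)) \in st' \/ s x = x.
  move=> xL; have [in_st|] := st_full x (sub x xL); last by right.
  left; rewrite mem_filter in_st andbT /= (inj_eq code_inj).
  by apply: contraNneq aL => <-.
rewrite (inj_eq code_inj); have [sa_b|sa_b] := eqVneq (s a) b.
  case: (add_arcs _ _) (IHL s st' kappa UL) => st2 k /= IH.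
  rewrite addnCA addnS -IH //.
  - move=> x; have [->|xa xL] := eqVneq x a => //.
    by rewrite s_phi // inE negb_or xa.
  - by move=> x y xL yL; apply: kappa_inj; rewrite sub.
(* The fragment ending at a is followed by the one beginning at b, whose end is
   a'. *)
pose a' := (s^-1)%g b; have sa' : s a' = b by rewrite permKV.
have a'a : a' != a by apply: contraNneq sa_b => <-; rewrite sa'.
have a'L : a' \in L.
  apply/negPn/negP=> a'L; case/eqP: (a'a); apply: (@perm_inj _ phi).
  by rewrite -[RHS]sa' s_phi // inE negb_or a'a.
pose s' := (tperm a a' * s)%g.
pose kappa' x := if kappa x == kappa a then kappa a' else kappa x.
have s'a' : s' a' = s a by rewrite permM tpermR.
have s'E x : x != a -> x != a' -> s' x = s x.
  by move=> xa xa'; rewrite permM tpermD // eq_sym.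
have kappa_orb x y : x \in porbit s y -> kappa x = kappa y.
  case/porbitP=> i ->; elim: i => [|i IHi]; rewrite ?perm1 //.
  by rewrite expgSr permM kappa_s.
have porbits_s' : #|porbits s'|.+1 = #|porbits s|.
  have := porbits_mul_tperm s a a'; rewrite -/s' eq_sym a'a.
  have -> : a \notin porbit s a'.
    apply: contraNN a'a => /kappa_orb e.
    by rewrite (kappa_inj _ _ aaL (sub _ a'L) e).
  by rewrite /= addn1 -[_.*2]/2 addn2 => -[].
have s'_phi x : x \notin L -> s' x = phi x.
  have [-> _|xa xL] := eqVneq x a; first by rewrite permM tpermL sa'.
  have xa' : x != a' by apply: contraNneq xL => ->.
  by rewrite s'E // s_phi // inE negb_or xa.
have kappa'_s' x : kappa' (s' x) = kappa' x.
  rewrite /kappa'; have [->|xa] := eqVneq x a.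
    have <- : kappa b = kappa a' by rewrite -sa' kappa_s.
    by rewrite permM tpermL sa' eqxx if_same.
  have [->|xa'] := eqVneq x a'; last by rewrite s'E // kappa_s.
  by rewrite s'a' kappa_s eqxx if_same.
have kappa'_inj : {in L &, injective kappa'}.
  have kappa'E x : x \in L -> kappa' x = kappa x.
    move=> xL; rewrite /kappa'; case: eqP => // /kappa_inj xa.
    by rewrite -(xa (sub _ xL) aaL) xL in aL.
  by move=> x y xL yL; rewrite !kappa'E //; apply: kappa_inj; rewrite sub.
have IH st1 h1 h2 := IHL s' st1 kappa' UL s'_phi h1 h2 kappa'_s' kappa'_inj.
have step st1 : #|porbits phi| + size L
      = #|porbits s'|
        + (add_arcs st1 [seq (code x, code (phi x)) | x <- L]).2 ->
    #|porbits phi| + (size L).+1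
      = #|porbits s| + (add_arcs st1 [seq (code x, code (phi x)) | x <- L]).2.
  by move=> e; rewrite addnS e -porbits_s'.
have st'_val p : p \in st' -> p.2 = code b -> p = (code a', code b).
  case/st'_sound=> x xL -> /= /code_inj sx.
  by rewrite sx; congr (code _, _); apply: (@perm_inj _ s); rewrite sx sa'.
have xa_L x : x \in L -> x != a by apply: contraTneq => ->.
have [has_b|no_b] := boolP (has _ st').
  set st1 := [seq _ | p <- st'].
  case E: (add_arcs st1 _) (step st1) => [st2 k] /=; rewrite add0n; apply.
  rewrite -[k]/((st2, k).2) -E; apply: IH.
  - move=> _ /mapP[p pst' ->]; case: eqP => [p2|p2].
      by exists a'; rewrite // (st'_val p pst' p2) s'a'.
    have [x xL pE] := st'_sound p pst'; exists x => //.
    rewrite s'E ?xa_L //; apply: contra_not_neq p2 => xa'.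
    by rewrite pE xa' /= sa'.
  - have [p pst' /eqP p2] := hasP has_b; have pE := st'_val p pst' p2.
    move=> x xL; have [->|xa'] := eqVneq x a'.
      by left; apply/mapP; exists p; rewrite ?p2 ?eqxx // pE s'a'.
    rewrite s'E ?xa_L //; case: (st'_full x xL) => [in_st|]; [left|by right].
    apply/mapP; exists (code x, code (s x)) => //=.
    rewrite (inj_eq code_inj) -sa' (inj_eq perm_inj) (negPf xa').
    by [].
set st1 := _ :: st'.
case E: (add_arcs st1 _) (step st1) => [st2 k] /=; rewrite add0n; apply.
have a'b : a' = b.
  case: (st'_full a' a'L); rewrite sa' // => in_st.
  by have /hasPn/(_ _ in_st) := no_b; rewrite eqxx.
rewrite -[k]/((st2, k).2) -E; apply: IH.
- move=> p; rewrite inE => /predU1P[->|pst'].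
    by exists a'; rewrite // s'a' a'b.
  have [x xL pE] := st'_sound p pst'; exists x => //.
  rewrite s'E ?xa_L //; apply: contraTneq pst' => xa'.
  apply: contra no_b => pst'; apply/hasP; exists p => //.
  by rewrite pE xa' sa' eqxx.
move=> x xL; have [->|xa'] := eqVneq x a'.
  by left; rewrite s'a' a'b mem_head.
rewrite s'E ?xa_L //; case: (st'_full x xL) => [in_st|]; [left|by right].
by rewrite inE in_st orbT.
Qed.

Lemma add_arcs_faces (C : seq (N * N)) :
    (forall p, p \in C -> exists d, p = (code d, code (phi d))) ->
    (forall d, code d \in [seq p.1 | p <- C]) -> size C = #|D| ->
  #|porbits phi| = (add_arcs [::] C).2.
Proof.
move=> CE Call sC.
have [L CL] : exists L, C = [seq (code d, code (phi d)) | d <- L].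
  elim: C CE {Call sC} => [|p C IHC] CE; first by exists [::].
  have [|L ->] := IHC; first by move=> q qC; apply: CE; rewrite inE qC orbT.
  by have [d ->] := CE p (mem_head _ _); exists (d :: L).
have Lall d : d \in L.
  have := Call d; rewrite CL -map_comp => /mapP[e eL /code_inj->].
  by [].
have UL : uniq L.
  apply: (leq_size_uniq (enum_uniq D)) => [d _|]; first exact: Lall.
  by rewrite -cardE -sC CL size_map.
have sL : size L = #|D| by rewrite -sC CL size_map.
apply/(@addIn #|D|); rewrite -{1}sL -porbits1 [RHS]addnC CL.
apply: (@add_arcs_porbits L 1%g [::] id UL) => // [a|a _|a].
- by rewrite Lall.
- by right; rewrite perm1.
- by rewrite perm1.
Qed.
End FaceTracing.

(** * Summing over all choices by dynamic programming *)

Lemma add_arcs_cat (st : fragments) (L1 L2 : seq (N * N)) :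
  (add_arcs st (L1 ++ L2)).2
    = (add_arcs st L1).2 + (add_arcs (add_arcs st L1).1 L2).2.
Proof.
elim: L1 st => [|ab L1 IHL] st; first by rewrite /= add0n.
rewrite [add_arcs _ (_ ++ _)]/= [add_arcs st (_ :: _)]/=.
case: add_arc => st1 closed; move: (IHL st1).
case: (add_arcs st1 (L1 ++ L2)) => st2 k /= ->.
by case: (add_arcs st1 L1) => st3 k3 /=; rewrite addnA.
Qed.

(** One entry for each vertex: the arcs added by its two rotations. *)
Definition program := seq (seq (N * N) * seq (N * N)).

Definition chosen_arcs (pr : program) (bs : seq bool) : seq (N * N) :=
  flatten [seq if p.2 then p.1.1 else p.1.2 | p <- zip pr bs].

Fixpoint closings (pr : program) (st : fragments) : nat :=
  if pr is (L1, L2) :: pr' then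
    let: (st1, k1) := add_arcs st L1 in
    let: (st2, k2) := add_arcs st L2 in
    2 ^ size pr' * (k1 + k2) + (closings pr' st1 + closings pr' st2)
  else 0.

Lemma closings_sum (pr : program) (st : fragments) :
  closings pr st
    = \sum_(bs : (size pr).-tuple bool) (add_arcs st (chosen_arcs pr bs)).2.
Proof.
elim: pr st => [|[L1 L2] pr IHpr] st /=.
  by rewrite big1 // => bs _; rewrite [bs]tuple0.
rewrite big_tuple_cons big_bool /=.
have branchE L :
    \sum_(t : (size pr).-tuple bool) (add_arcs st (L ++ chosen_arcs pr t)).2
    = 2 ^ size pr * (add_arcs st L).2 + closings pr (add_arcs st L).1.
  under eq_bigr => t _ do rewrite add_arcs_cat.
  by rewrite big_split /= sum_nat_const card_tuple card_bool -IHpr.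
rewrite !branchE; case: (add_arcs st L1) => st1 k1.
by case: (add_arcs st L2) => st2 k2 /=; rewrite mulnDr addnACA.
Qed.

Fixpoint merge (st : fragments) (c : N) (L : seq (fragments * N)) :=
  if L is (st', c') :: L' then
    if st == st' then (st', N.add c c') :: L' else (st', c') :: merge st c L'
  else [:: (st, c)].

Definition branch (L1 L2 : seq (N * N)) (L : seq (fragments * N)) :
    seq (fragments * nat * N) :=
  [seq (add_arcs p.1 L12, p.2) | p <- L, L12 <- [:: L1; L2]].

Definition gain (next : seq (fragments * nat * N)) : N :=
  foldr (fun q => N.add (N.mul q.2 (bin_of_nat q.1.2))) N0 next.

Definition merge_all (next : seq (fragments * nat * N)) : seq (fragments * N) :=
  foldr (fun q => merge q.1.1 q.2) [::] next.

(** The list pairs the states that can be reached with the number of choices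
    leading to them; the closings of one step are weighted by the number of
    choices still to be made. *)
Fixpoint closings_dp (pr : program) (L : seq (fragments * N)) : N :=
  if pr is (L1, L2) :: pr' then
    let next := branch L1 L2 L in
    N.add (N.mul (iter (size pr') N.double 1%num) (gain next))
          (closings_dp pr' (merge_all next))
  else N0.

Lemma nat_of_Nadd (a b : N) : N.add a b = a + b :> nat.
Proof. by case: a b => [|p] [|q] //=; rewrite ?addn0 ?nat_of_add_pos. Qed.
Lemma nat_of_Nmul (a b : N) : N.mul a b = a * b :> nat.
Proof. by case: a b => [|p] [|q] //=; rewrite ?muln0 ?nat_of_mul_pos. Qed.

Lemma merge_sum (f : fragments -> nat) st c L :
  \sum_(p <- merge st c L) p.2 * f p.1 = c * f st + \sum_(p <- L) p.2 * f p.1.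
Proof.
elim: L => [|[st' c'] L IHL] /=; first by rewrite big_seq1 big_nil addn0.
case: eqP => [->|_]; rewrite !big_cons /=; last by rewrite IHL addnCA.
by rewrite nat_of_Nadd mulnDl addnA.
Qed.

Lemma closings_dpE (pr : program) (L : seq (fragments * N)) :
  closings_dp pr L = \sum_(p <- L) p.2 * closings pr p.1 :> nat.
Proof.
elim: pr L => [|[L1 L2] pr IHpr] L.
  by rewrite big1 // => p _; rewrite muln0.
set next := branch L1 L2 L.
transitivity (N.add (N.mul (iter (size pr) N.double 1%num) (gain next))
  (closings_dp pr (merge_all next)) : nat); first by [].
rewrite nat_of_Nadd nat_of_Nmul IHpr.
have -> : iter (size pr) N.double 1%num = 2 ^ size pr :> nat.
  elim: (size pr) => //= n; rewrite expnS mul2n => <-.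
  by case: (iter n _ _) => //= p; rewrite natTrecE.
have -> : gain next = \sum_(q <- next) q.2 * q.1.2 :> nat.
  elim: next => [|q next' IH] /=; first by rewrite big_nil.
  by rewrite big_cons nat_of_Nadd nat_of_Nmul bin_of_natK IH.
have -> : \sum_(p <- merge_all next) p.2 * closings pr p.1
    = \sum_(q <- next) q.2 * closings pr q.1.1.
  elim: next => [|q next' IH]; first by rewrite !big_nil.
  by rewrite /= merge_sum big_cons IH.
rewrite big_distrr -big_split /= big_allpairs_dep /=.
apply: eq_bigr => -[st c] _; rewrite !big_cons big_nil /=.
case: (add_arcs st L1) => st1 k1; case: (add_arcs st L2) => st2 k2 /=.
by rewrite addn0 addnACA !mulnDr !(mulnCA c).
Qed.

(** * The sum of the numbers of faces for a graph given by its edges *)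

Definition chiral_rot (G : sgraph) (v : G) (b : bool) : {perm G} :=
  if enum (neighbours v) is [:: x; y; z]
  then if b then cyc3 x y z else cyc3 x z y else 1%g.

(** Rotation systems of a cubic graph amount to a sign at each vertex. *)
Lemma chiral_rotations (G : sgraph) : cubic G ->
  exists2 h : {ffun G -> bool} -> rotation_system G,
    bijective h & forall b v, rot (h b) v = chiral_rot v (b v).
Proof.
move=> G3.
have chiral_cyc (b : {ffun G -> bool}) :
    [forall v,
      cyclic_ordering (neighbours v) ([ffun v => chiral_rot v (b v)] v)].
  apply/forallP=> v; rewrite ffunE /chiral_rot.
  have [x [y [z [U -> ->]]]] := cards3P (G3 v).
  by rewrite cyclic_ordering3 //; case: (b v); rewrite eqxx ?orbT.
pose h (b : {ffun G -> bool}) : rotation_system G :=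
  Sub [ffun v => chiral_rot v (b v)] (chiral_cyc b).
have hE b v : rot (h b) v = chiral_rot v (b v) by rewrite /rot SubK ffunE.
exists h => //.
exists (fun rho => [ffun v => rot rho v == chiral_rot v true]) => [b|rho].
  apply/ffunP=> v; rewrite ffunE hE; case: (b v); first by rewrite eqxx.
  rewrite /chiral_rot; have [x [y [z [U -> _]]]] := cards3P (G3 v).
  have U' := uniq3_swap U.
  apply/eqP=> /permP/(_ x); rewrite !cyc3E // eqxx => zy.
  by move: U => /and3P[_]; rewrite zy inE eqxx.
apply/val_inj/ffunP=> v; rewrite -/(rot _ v) -/(rot rho v) hE ffunE.
have := forallP (valP rho) v; rewrite -/(rot rho v) /chiral_rot.
have [x [y [z [U -> ->]]]] := cards3P (G3 v); rewrite cyclic_ordering3 //.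
by case: eqP => [->|_ /eqP->].
Qed.

Lemma sum_ffun_tuple (T : finType) (vs : seq T) (F : seq bool -> nat) :
    uniq vs -> (forall v, v \in vs) ->
  \sum_(b : {ffun T -> bool}) F (map b vs)
    = \sum_(bs : (size vs).-tuple bool) F bs.
Proof.
move=> Uvs vsT; pose t (b : {ffun T -> bool}) := map_tuple b (in_tuple vs).
rewrite (reindex t) //=.
pose t' (bs : (size vs).-tuple bool) := [ffun v => nth false bs (index v vs)].
exists t' => [b|bs] _.
  by apply/ffunP=> v; rewrite ffunE /= (nth_map v) ?index_mem // nth_index.
apply: eq_from_tnth => i; rewrite tnth_map ffunE (tnth_nth false).
by rewrite (tnth_nth (tnth (in_tuple vs) i)) index_uniq.
Qed.

Section EdgeList.
Variables (n : nat) (E : seq (nat * nat)).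
Let G := graph_of_edges n E.

Definition nbrs (v : nat) : seq nat :=
  [seq u <- iota 0 n | (v != u) && (((v, u) \in E) || ((u, v) \in E))].

Definition dart_code (u v : nat) : N := bin_of_nat (u * n + v).

(** The two lists are ordered so that the arcs leading to the same dart occupy
    the same position in both: then fragments that do not occur yet are created
    in the same order for both rotations, and equal pairings are represented by
    equal lists. *)
Definition vertex_arcs (v : nat) : seq (N * N) * seq (N * N) :=
  if nbrs v is [:: x; y; z] then
    ([:: (dart_code x v, dart_code v y); (dart_code y v, dart_code v z);
         (dart_code z v, dart_code v x)],
     [:: (dart_code z v, dart_code v y); (dart_code x v, dart_code v z);
         (dart_code y v, dart_code v x)])
  else ([::], [::]).

Lemma nbrsE (v : G) : nbrs v = map val (enum (neighbours v)).
Proof.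
rewrite /nbrs -val_enum_ord filter_map; congr (map _ _).
rewrite enumT [RHS]/enum_mem; apply: eq_filter => u.
by rewrite [RHS]inE.
Qed.

Lemma dart_code_inj :
  injective (fun d : dart G => dart_code (val (tail d)) (val (head d))).
Proof.
move=> d e /(can_inj bin_of_natK) eq_code.
have n0 : 0 < n by apply: leq_ltn_trans (ltn_ord (tail d)).
apply: dart_eq; apply: val_inj.
  have := congr1 (divn^~ n) eq_code.
  by rewrite !divnMDl // !divn_small ?ltn_ord // !addn0.
have := congr1 (modn^~ n) eq_code.
by rewrite !modnMDl !modn_small ?ltn_ord.
Qed.

Definition all_cubic := all (fun v => size (nbrs v) == 3) (iota 0 n).

Lemma all_cubicP : all_cubic -> cubic G.
Proof.
move=> cub v; rewrite cardE -(size_map val) -nbrsE; apply/eqP.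
by apply: (allP cub); rewrite mem_iota ltn_ord.
Qed.

(** Any order of the vertices is correct; a good one keeps the number of states
    small. *)
Lemma sum_num_faces (ord : seq nat) :
    all_cubic -> perm_eq ord (iota 0 n) ->
  \sum_(rho : rotation_system G) num_faces rho
    = closings_dp (map vertex_arcs ord) [:: ([::], 1%num)].
Proof.
move=> /all_cubicP G3 ord_perm.
have [vs ordE] : exists vs : seq G, ord = map val vs.
  have: all (gtn n) ord.
    by apply/allP=> v; rewrite (perm_mem ord_perm) mem_iota.
  elim: ord {ord_perm} => [|v ord IHord] /=; first by exists [::].
  by case/andP=> vn /IHord[vs ->]; exists (Ordinal vn :: vs).
have Uvs : uniq vs.
  by rewrite -(map_inj_uniq val_inj) -ordE (perm_uniq ord_perm) iota_uniq.
have vsG v : v \in vs.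
  by rewrite -(mem_map val_inj) -ordE (perm_mem ord_perm) mem_iota /=.
have [h h_bij hE] := chiral_rotations G3.
rewrite (reindex h) /=; last exact: onW_bij.
rewrite closings_dpE big_seq1 mul1n closings_sum ordE -map_comp size_map.
rewrite -(sum_ffun_tuple (fun bs =>
  (add_arcs [::] (chosen_arcs (map (vertex_arcs \o val) vs) bs)).2)) //.
apply: eq_bigr => b _; rewrite /num_faces /faces.
pose arcs (v : G) :=
  if b v then (vertex_arcs (val v)).1 else (vertex_arcs (val v)).2.
have -> : chosen_arcs (map (vertex_arcs \o val) vs) (map b vs)
    = flatten [seq arcs v | v <- vs].
  by rewrite /chosen_arcs; congr flatten; elim: (vs) => //= v s ->.
pose arc (v u : G) := (dart_code (val u) (val v),
                       dart_code (val v) (val (rot (h b) v u))).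
have arcsE (v : G) : perm_eq (arcs v) (map (arc v) (enum (neighbours v))).
  have [x [y [z [U eN _]]]] := cards3P (G3 v).
  rewrite /arcs /vertex_arcs nbrsE eN /arc hE /chiral_rot eN /=.
  have U' := uniq3_swap U.
  have [/and3P[]] := (U, U'); rewrite !inE negb_or => /andP[xy xz] yz _ _.
  have neqs := (negPf xy, negPf xz, negPf yz,
                eq_sym y x, eq_sym z x, eq_sym z y).
  case: (b v); rewrite !cyc3E // !eqxx !neqs //.
  by rewrite perm_sym -[X in perm_eq X _]/(rcons [:: _; _] _) perm_rcons.
have mem_arcs (v : G) p :
    (p \in arcs v) = (p \in map (arc v) (enum (neighbours v))).
  exact: perm_mem.
apply: (add_arcs_faces dart_code_inj) => [p|d|].
- case/flatten_mapP=> v _; rewrite mem_arcs => /mapP[u].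
  rewrite mem_enum inE => vu ->; have uv : adj u v by rewrite adj_sym.
  by exists (Sub (u, v) uv : dart G); rewrite permE.
- apply/mapP; exists (arc (head d) (tail d)) => //.
  apply/flatten_mapP; exists (head d) => //; rewrite mem_arcs map_f //.
  by rewrite mem_enum inE adj_sym adj_dart.
rewrite card_cubic_darts // size_flatten /shape -map_comp sumnE big_map.
rewrite (eq_bigr (fun=> 3)) => [|v _]; last first.
  by rewrite /= (perm_size (arcsE v)) size_map -cardE; apply: G3.
rewrite big_const_seq count_predT iter_addn_0; congr (_ * _).
by rewrite -(card_uniqP Uvs); apply: eq_card.
Qed.
End EdgeList.

(** * Certificates for connectedness and cospectrality *)

Section Certificates.
Variable n : nat.

Fixpoint grows_from (E : seq (nat * nat)) (seen ord : seq nat) : bool :=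
  if ord is v :: ord' then
    has (mem (nbrs n E v)) seen && grows_from E (v :: seen) ord'
  else true.

(** The order in which [closings_dp] processes the vertices also proves
    connectedness, if every vertex but the first has an earlier neighbour. *)
Definition connected_order (E : seq (nat * nat)) (ord : seq nat) : bool :=
  if ord is r :: ord' then perm_eq ord (iota 0 n) && grows_from E [:: r] ord'
  else false.

Lemma connected_orderP (E : seq (nat * nat)) (ord : seq nat) :
  connected_order E ord -> connected (graph_of_edges n E).
Proof.
set G := graph_of_edges n E; case: ord => // r ord /andP[ord_perm grow].
have lt_n v : (v \in r :: ord) = (v < n).
  by rewrite (perm_mem ord_perm) mem_iota.
have rn : r < n by rewrite -lt_n mem_head.
pose root : G := Ordinal rn.
have conn_sym := sym_connect_sym (@adj_sym G).
have nbrs_adj (u v : G) : val u \in nbrs n E (val v) -> adj v u.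
  by rewrite nbrsE (mem_map val_inj) mem_enum inE.
have reach (seen s : seq nat) :
    (forall v : G, val v \in seen -> connect (@adj G) root v) ->
    {in seen, forall v, v < n} -> {in s, forall v, v < n} ->
    grows_from E seen s ->
    forall v : G, val v \in s -> connect (@adj G) root v.
  elim: s seen => //= w s IHs seen conn_seen lt_seen lt_s.
  case/andP=> /hasP[u us wu] grow_s.
  have conn_w (w' : G) : val w' = w -> connect (@adj G) root w'.
    move=> w'E; have un := lt_seen u us.
    have adj_w : adj w' (Ordinal un : G) by apply: nbrs_adj; rewrite w'E.
    rewrite adj_sym in adj_w.
    exact: connect_trans (conn_seen (Ordinal un) us) (connect1 adj_w).
  move=> v; rewrite inE => /predU1P[/conn_w //|vs].
  apply: (IHs (w :: seen)) vs => //.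
  - by move=> x; rewrite inE => /predU1P[/conn_w //|]; apply: conn_seen.
  - move=> x; rewrite inE => /predU1P[->|]; last exact: lt_seen.
    by rewrite lt_s ?mem_head.
  - by move=> x xs; rewrite lt_s // inE xs orbT.
have all_root (v : G) : connect (@adj G) root v.
  have : val v \in r :: ord by rewrite lt_n ltn_ord.
  rewrite inE => /predU1P[vr|].
    by rewrite (_ : v = root) //; apply: val_inj.
  apply: (reach [:: r]) => //.
  - move=> x; rewrite inE => /eqP xr.
    by rewrite (_ : x = root) //; apply: val_inj.
  - by move=> x; rewrite inE => /eqP->.
  - by move=> x xs; rewrite -lt_n inE xs orbT.
split; first by apply/card_gt0P; exists root.
by move=> u v; apply: connect_trans (all_root v); rewrite conn_sym.
Qed.

(** A matrix of natural numbers is given by its rows, each of them a multiset of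
    columns; matrix multiplication then concatenates rows. *)
Local Notation rows := (seq (seq nat)).

Definition rows_mx (L : rows) : 'M[algC]_#|'I_n| :=
  (\matrix_(i, j)
    (count_mem (val (enum_val j)) (nth [::] L (val (enum_val i))))%:R)%R.

Definition rows_mul (L L' : rows) : rows :=
  [seq flatten [seq nth [::] L' k | k <- r] | r <- L].

Definition rows_tr (L : rows) : rows :=
  [seq [seq i <- iota 0 n | j \in nth [::] L i] | j <- iota 0 n].

Definition rows_wf (L : rows) : bool := (size L == n) && all (all (gtn n)) L.

Definition rows_eq (L L' : rows) : bool :=
  all (fun i => perm_eq (nth [::] L i) (nth [::] L' i)) (iota 0 n).

Definition adj_rows (E : seq (nat * nat)) : rows := map (nbrs n E) (iota 0 n).

Lemma rows_mxM (L L' : rows) :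
  rows_wf L -> rows_mx (rows_mul L L') = (rows_mx L *m rows_mx L')%R.
Proof.
case/andP=> /eqP sL wfL; apply/matrixP=> i j; rewrite !mxE.
set a := val (enum_val i); set b := val (enum_val j).
have an : a < n by apply: ltn_ord.
under eq_bigr => k _ do rewrite !mxE.
rewrite (big_ord_enum_val _ (fun x : 'I_n =>
  ((count_mem (val x) (nth [::] L a))%:R
    * (count_mem b (nth [::] L' (val x)))%:R)%R)) /=.
rewrite (nth_map [::]) ?sL //.
have : all (gtn n) (nth [::] L a) by apply: (allP wfL); rewrite mem_nth ?sL.
elim: (nth [::] L a) => [_|x r IHr /= /andP[xn /IHr]] /=.
  by rewrite big1 // => k _; rewrite mul0r.
rewrite count_cat natrD => ->.
under [RHS]eq_bigr => k _ do rewrite natrD mulrDl.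
rewrite big_split /=; congr (_ + _)%R.
rewrite (bigD1 (Ordinal xn)) //= eqxx mul1r big1 ?addr0 // => k.
by rewrite -val_eqE /= eq_sym => /negPf->; rewrite mul0r.
Qed.

Lemma rows_eq_mx (L L' : rows) : rows_eq L L' -> rows_mx L = rows_mx L'.
Proof.
move=> LL'; apply/matrixP=> i j; rewrite !mxE; congr _%:R.
apply/seq.permP/(allP LL'); rewrite mem_iota; exact: ltn_ord.
Qed.

Lemma adj_rows_mx (E : seq (nat * nat)) :
  rows_mx (adj_rows E) = adjacency_mx (graph_of_edges n E).
Proof.
apply/matrixP=> i j; rewrite !mxE; congr _%:R.
rewrite (nth_map 0) ?size_iota ?nth_iota ?ltn_ord // add0n nbrsE.
rewrite count_uniq_mem ?(map_inj_uniq val_inj) ?enum_uniq //.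
by rewrite (mem_map val_inj) mem_enum inE.
Qed.

Definition adjacency_inverse (E : seq (nat * nat)) (c : int)
    (M : seq (seq int)) : bool :=
  all (fun i => all (fun j =>
    foldr (fun k s => nth 0 (nth [::] M k) j + s)%R 0%R (nbrs n E i)
      == (if i == j then c else 0%R)) (iota 0 n)) (iota 0 n).

Lemma adjacency_inverseP (E : seq (nat * nat)) (c : int) (M : seq (seq int)) :
    c != 0%R -> adjacency_inverse E c M ->
  (\det (adjacency_mx (graph_of_edges n E)) != 0)%R.
Proof.
move=> c0 inv; set A := adjacency_mx _.
pose B : 'M[algC]_#|'I_n| := (\matrix_(k, j)
  (nth 0 (nth [::] M (val (enum_val k))) (val (enum_val j)))%:~R)%R.
have AB : (A *m B = c%:~R%:M)%R.
  apply/matrixP=> i j; rewrite !mxE.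
  under eq_bigr => k _ do rewrite !mxE.
  rewrite (big_ord_enum_val _ (fun x : 'I_n => ((edge_rel E (enum_val i) x)%:R *
     (nth 0 (nth [::] M (val x)) (val (enum_val j)))%:~R)%R)) /=.
  have /allP/(_ (val (enum_val i))) := inv; rewrite mem_iota ltn_ord => /(_ isT).
  move/allP/(_ (val (enum_val j))); rewrite mem_iota ltn_ord => /(_ isT)/eqP.
  rewrite val_eqE (inj_eq enum_val_inj).
  move/(congr1 (fun x : int => x%:~R : algC)%R).
  have -> : ((if i == j then c else 0)%:~R = c%:~R *+ (i == j) :> algC)%R.
    by case: ifP.
  move=> <-; rewrite nbrsE.
  rewrite (bigID (mem (@neighbours (graph_of_edges n E) (enum_val i)))) /=.
  rewrite [X in (_ + X)%R]big1.
    rewrite addr0 -big_enum.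
    rewrite (eq_big_seq (fun k =>
      (nth 0 (nth [::] M (val k)) (val (enum_val j)))%:~R)%R).
      elim: (enum _) => [|k s IHs] /=; first by rewrite big_nil.
      by rewrite big_cons rmorphD IHs.
    by move=> k; rewrite mem_enum inE => /= ->; rewrite mul1r.
  by move=> k; rewrite inE => /= /negPf->; rewrite mul0r.
have := congr1 (fun X => \det X)%R AB; rewrite det_mulmx det_scalar => detAB.
apply: contraTneq isT => detA0; move/eqP: detAB.
by rewrite detA0 mul0r eq_sym expf_eq0 intr_eq0 (negPf c0) andbF.
Qed.

(** The conditions A1 Q = Q A2 and Q Q^T = A1^2.  The second one makes Q
    invertible as soon as A1 is, without an inverse of Q being given. *)
Definition cospectral_certificate (E1 E2 : seq (nat * nat)) (Q : rows) : bool :=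
  [&& rows_wf Q,
      rows_eq (rows_mul (adj_rows E1) Q) (rows_mul Q (adj_rows E2))
    & rows_eq (rows_mul Q (rows_tr Q)) (rows_mul (adj_rows E1) (adj_rows E1))].

Lemma adj_rows_wf (E : seq (nat * nat)) : rows_wf (adj_rows E).
Proof.
rewrite /rows_wf size_map size_iota eqxx; apply/allP=> _ /mapP[i _ ->].
by apply/allP=> j; rewrite mem_filter mem_iota => /andP[_].
Qed.

Lemma cospectral_certificateP (E1 E2 : seq (nat * nat)) (Q : rows) :
    (\det (adjacency_mx (graph_of_edges n E1)) != 0)%R ->
    cospectral_certificate E1 E2 Q ->
  cospectral (graph_of_edges n E1) (graph_of_edges n E2).
Proof.
move=> detA /and3P[wfQ /rows_eq_mx AQ /rows_eq_mx QQ]; apply/cospectralP.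
move: AQ QQ; rewrite !rows_mxM ?adj_rows_wf // !adj_rows_mx => AQ QQ.
apply: char_poly_intertwine AQ.
have /(congr1 (fun X => \det X)%R) := QQ; rewrite !det_mulmx => dQQ.
have := mulf_neq0 detA detA.
by rewrite -dQQ mulf_eq0 negb_or => /andP[].
Qed.

End Certificates.

(** * The two families *)

Definition graph_certificate (n : nat) (E0 E : seq (nat * nat))
    (ord : seq nat) (total : N) (Q : seq (seq nat)) : bool :=
  [&& all_cubic n E, connected_order n E ord,
      closings_dp (map (vertex_arcs n E) ord) [:: ([::], 1%num)] == total
    & cospectral_certificate n E0 E Q].

Local Open Scope ring_scope.

Lemma expectation_num_faces (n : nat) (E : seq (nat * nat)) (ord : seq nat) :
    all_cubic n E -> connected_order n E ord ->
  expectation (@num_faces (graph_of_edges n E))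
    = (closings_dp (map (vertex_arcs n E) ord) [:: ([::], 1%num)] : nat)%:R
        / (2 ^ n)%N%:R.
Proof.
move=> cub; case: ord => // v ord /andP[ord_perm _].
rewrite /expectation card_cubic_rotations; last exact: all_cubicP.
rewrite -natr_sum (sum_num_faces cub ord_perm); congr (_ / (2 ^ _)%N%:R).
exact: card_ord.
Qed.

(** All members are certified cospectral to one of them, whose adjacency matrix
    is invertible.  Since their short-face contributions agree, their long-face
    contributions differ as soon as the sums of the numbers of faces do. *)
Lemma certified_family (n m : nat) (E : 'I_m -> seq (nat * nat))
    (ord : 'I_m -> seq nat) (total : 'I_m -> N) (Q : 'I_m -> seq (seq nat))
    (i0 : 'I_m) (G := fun i => graph_of_edges n (E i)) :
    \det (adjacency_mx (G i0)) != 0 -> injective total ->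
    (forall i, graph_certificate n (E i0) (E i) (ord i) (total i) (Q i)) ->
  (forall i, connected (G i) /\ cubic (G i)) /\
  (forall i j, i != j ->
     [/\ cospectral (G i) (G j), short_faces (G i) = short_faces (G j)
       & long_faces (G i) <> long_faces (G j)]).
Proof.
move=> det0 total_inj cert.
have conn_cub i : connected (G i) /\ cubic (G i).
  by have /and4P[cub conn _ _] := cert i; split;
    [apply: connected_orderP conn | apply: all_cubicP].
split; first exact: conn_cub.
move=> i j ij; have GiGj : cospectral (G i) (G j).
  have /and4P[_ _ _ /(cospectral_certificateP det0)/cospectralP ei] := cert i.
  have /and4P[_ _ _ /(cospectral_certificateP det0)/cospectralP ej] := cert j.
  by apply/cospectralP; rewrite -ei -ej.
have [[conni cubi] [connj cubj]] := (conn_cub i, conn_cub j).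
have short_eq := cospectral_short_faces conni cubi connj cubj GiGj.
split; [exact: GiGj | exact: short_eq | rewrite /long_faces short_eq].
move/addIr; have /and4P[ci oi /eqP ti _] := cert i.
have /and4P[cj oj /eqP tj _] := cert j.
rewrite (expectation_num_faces ci oi) (expectation_num_faces cj oj) ti tj.
have pow_neq0 : (2 ^ n)%N%:R^-1 != 0 :> rat.
  by rewrite invr_eq0 pnatr_eq0 -lt0n expn_gt0.
move/(mulIf pow_neq0)/eqP; rewrite eqr_nat.
by move/eqP/(can_inj nat_of_binK)/total_inj => e; rewrite e eqxx in ij.
Qed.

(** At most 6 edges leave an initial segment of any of these orders. *)
Definition order_G1 : seq nat :=
  [:: 4; 14; 15; 6; 0; 7; 10; 13; 5; 12; 1; 9; 3; 2; 8; 11].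

Definition order_G2 : seq nat :=
  [:: 2; 8; 10; 0; 9; 11; 6; 13; 4; 3; 1; 12; 5; 14; 15; 7].

Definition order_G3 : seq nat :=
  [:: 0; 5; 10; 9; 1; 11; 12; 2; 4; 3; 13; 7; 6; 14; 15; 8].

(** Rows of 0/1 matrices that intertwine the adjacency matrix of G1 with that
    of the graph named; they have three ones in each row and column. *)
Definition intertwiner_G2 : seq (seq nat) :=
  [:: [:: 7; 11; 12]; [:: 3; 6; 10]; [:: 2; 10; 11]; [:: 2; 3; 4];
      [:: 3; 5; 7]; [:: 4; 6; 11]; [:: 5; 6; 7]; [:: 1; 4; 5]; [:: 0; 2; 8];
      [:: 8; 13; 14]; [:: 0; 13; 15]; [:: 8; 9; 10]; [:: 0; 1; 9];
      [:: 9; 12; 13]; [:: 1; 14; 15]; [:: 12; 14; 15]].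

Definition intertwiner_G3 : seq (seq nat) :=
  [:: [:: 8; 12; 13]; [:: 6; 10; 11]; [:: 0; 10; 12]; [:: 0; 4; 11];
      [:: 4; 6; 8]; [:: 7; 11; 12]; [:: 6; 7; 8]; [:: 3; 4; 7]; [:: 0; 1; 5];
      [:: 1; 9; 14]; [:: 1; 2; 15]; [:: 5; 9; 10]; [:: 2; 3; 5];
      [:: 2; 9; 13]; [:: 3; 14; 15]; [:: 13; 14; 15]].

(** This is 6 times the inverse of the adjacency matrix of G1. *)
Definition inverse_G1 : seq (seq int) :=
  [:: [:: 2; 2; -1; -1; -1; -1; -1; 2; 2; -1; -1; -1; -1; 2; 5; -4];
      [:: 2; 2; -1; -1; -1; -1; -1; 2; 2; 2; 2; -1; -1; -1; -1; -1];
      [:: -1; -1; -1; -1; 2; 2; -1; -1; 2; -1; -1; 2; 2; -1; -1; 2];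
      [:: -1; -1; -1; -1; 2; 2; -1; -1; 2; -1; -1; 2; -4; 5; 5; -4];
      [:: -1; -1; 2; 2; -1; -1; 2; -1; -4; 5; -1; -1; 5; -4; -4; 5];
      [:: -1; -1; 2; 2; -1; -1; 2; -1; -4; 2; 2; -1; 5; -1; -4; 2];
      [:: -1; -1; -1; -1; 2; 2; -1; -1; 2; -4; 2; 2; -4; 2; 5; -1];
      [:: 2; 2; -1; -1; -1; -1; -1; 2; 2; -1; -1; -1; -1; 2; -1; 2];
      [:: 2; 2; 2; 2; -4; -4; 2; 2; -4; 2; 2; 2; 2; -4; -4; 2];
      [:: -1; 2; -1; -1; 5; 2; -4; -1; 2; -1; -1; -1; -1; 2; 2; -1];
      [:: -1; 2; -1; -1; -1; 2; 2; -1; 2; -1; -1; -1; -1; 2; 2; -1];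
      [:: -1; -1; 2; 2; -1; -1; 2; -1; 2; -1; -1; -1; -1; 2; 2; -1];
      [:: -1; -1; 2; -4; 5; 5; -4; -1; 2; -1; -1; -1; -1; 2; 2; -1];
      [:: 2; -1; -1; 5; -4; -1; 2; 2; -4; 2; 2; 2; 2; -4; -4; 2];
      [:: 5; -1; -1; 5; -4; -4; 5; -1; -4; 2; 2; 2; 2; -4; -1; -1];
      [:: -4; -1; 2; -4; 5; 2; -1; 2; 2; -1; -1; -1; -1; 2; -1; 2]].

Definition orders16 : 3.-tuple (seq nat) :=
  [tuple order_G1; order_G2; order_G3].

(** The sums of the numbers of faces over the 2^16 rotation systems. *)
Definition totals16 : 3.-tuple N :=
  [tuple 192152%num; 191912%num; 191480%num].

(** The base graph G1 is intertwined with itself by its adjacency matrix. *)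
Definition intertwiners16 : 3.-tuple (seq (seq nat)) :=
  [tuple adj_rows 16 edges_G1; intertwiner_G2; intertwiner_G3].

(** At most 6 edges leave an initial segment of any of these orders. *)
Definition order_W1 : seq nat :=
  [:: 8; 11; 7; 6; 5; 9; 10; 16; 14; 12; 18; 13; 4; 17; 3; 1; 0; 2; 21; 20;
      15; 19].

Definition order_W2 : seq nat :=
  [:: 21; 3; 20; 15; 5; 14; 17; 0; 2; 18; 12; 13; 16; 1; 4; 6; 8; 7; 10; 9;
      19; 11].

Definition order_W3 : seq nat :=
  [:: 8; 7; 9; 11; 10; 16; 12; 4; 6; 13; 18; 2; 17; 5; 14; 15; 1; 0; 20; 3;
      19; 21].

Definition order_W4 : seq nat :=
  [:: 3; 0; 2; 21; 1; 18; 4; 16; 19; 7; 20; 15; 11; 8; 9; 10; 17; 5; 6; 13;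
      14; 12].

Definition order_W5 : seq nat :=
  [:: 8; 9; 11; 7; 4; 6; 13; 10; 16; 12; 5; 15; 17; 2; 18; 14; 1; 0; 3; 19;
      21; 20].

Definition order_W6 : seq nat :=
  [:: 10; 19; 9; 11; 5; 6; 7; 8; 13; 1; 16; 12; 18; 14; 4; 17; 2; 0; 3; 15;
      21; 20].

(** Rows of 0/1 matrices that intertwine the adjacency matrix of W5 with that
    of the graph named; they have three ones in each row and column. *)
Definition intertwiner_W1 : seq (seq nat) :=
  [:: [:: 1; 2; 3]; [:: 0; 16; 21]; [:: 0; 17; 18]; [:: 0; 19; 20];
      [:: 4; 5; 6]; [:: 12; 13; 15]; [:: 7; 9; 12]; [:: 8; 9; 13];
      [:: 6; 8; 11]; [:: 5; 7; 11]; [:: 9; 14; 16]; [:: 7; 8; 16];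
      [:: 6; 10; 18]; [:: 5; 10; 17]; [:: 4; 18; 20]; [:: 4; 17; 19];
      [:: 1; 10; 11]; [:: 2; 13; 14]; [:: 3; 12; 14]; [:: 2; 15; 21];
      [:: 3; 15; 21]; [:: 1; 19; 20]].

Definition intertwiner_W2 : seq (seq nat) :=
  [:: [:: 4; 7; 8]; [:: 5; 6; 9]; [:: 6; 12; 13]; [:: 6; 10; 11];
      [:: 1; 2; 3]; [:: 0; 16; 19]; [:: 0; 18; 21]; [:: 0; 17; 20];
      [:: 3; 14; 20]; [:: 3; 15; 21]; [:: 5; 17; 18]; [:: 5; 20; 21];
      [:: 2; 12; 14]; [:: 2; 13; 15]; [:: 1; 10; 12]; [:: 1; 11; 13];
      [:: 4; 14; 15]; [:: 8; 16; 17]; [:: 7; 16; 18]; [:: 8; 9; 19];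
      [:: 7; 9; 19]; [:: 4; 10; 11]].

Definition intertwiner_W3 : seq (seq nat) :=
  [:: [:: 1; 2; 3]; [:: 0; 16; 21]; [:: 0; 17; 18]; [:: 0; 19; 20];
      [:: 5; 6; 7]; [:: 4; 14; 15]; [:: 4; 8; 12]; [:: 4; 9; 13];
      [:: 7; 9; 10]; [:: 7; 8; 11]; [:: 12; 13; 16]; [:: 8; 9; 16];
      [:: 6; 10; 18]; [:: 6; 11; 17]; [:: 5; 18; 20]; [:: 5; 17; 19];
      [:: 1; 10; 11]; [:: 2; 13; 15]; [:: 2; 12; 14]; [:: 3; 15; 21];
      [:: 3; 14; 21]; [:: 1; 19; 20]].

Definition intertwiner_W4 : seq (seq nat) :=
  [:: [:: 8; 12; 17]; [:: 5; 6; 18]; [:: 5; 9; 16]; [:: 5; 13; 14];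
      [:: 3; 7; 15]; [:: 10; 11; 20]; [:: 0; 19; 20]; [:: 2; 4; 20];
      [:: 1; 2; 3]; [:: 0; 3; 21]; [:: 4; 18; 19]; [:: 0; 2; 18];
      [:: 1; 15; 16]; [:: 7; 16; 21]; [:: 9; 14; 15]; [:: 7; 9; 13];
      [:: 1; 17; 21]; [:: 4; 8; 11]; [:: 8; 10; 19]; [:: 6; 11; 12];
      [:: 6; 10; 12]; [:: 13; 14; 17]].

Definition intertwiner_W6 : seq (seq nat) :=
  [:: [:: 5; 7; 8]; [:: 4; 6; 9]; [:: 6; 12; 13]; [:: 6; 10; 11];
      [:: 1; 2; 3]; [:: 0; 16; 19]; [:: 0; 17; 20]; [:: 0; 18; 21];
      [:: 2; 15; 21]; [:: 3; 15; 20]; [:: 4; 17; 18]; [:: 4; 20; 21];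
      [:: 2; 13; 14]; [:: 3; 12; 14]; [:: 1; 11; 13]; [:: 1; 10; 12];
      [:: 5; 14; 15]; [:: 8; 16; 18]; [:: 7; 16; 17]; [:: 8; 9; 19];
      [:: 7; 9; 19]; [:: 5; 10; 11]].

(** This is 84 times the inverse of the adjacency matrix of W5. *)
Definition inverse_W5 : seq (seq int) :=
  [:: [:: -8; -8; 40; 52; 40; -8; 4; 4; -20; -20; -8; 16; -20; -20; -20; -20;
          40; 4; 4; 4; 4; -32];
      [:: -8; -8; 40; -32; 40; -8; 4; 4; -20; -20; -8; 16; -20; -20; -20; -20;
          40; 4; 4; 4; 4; 52];
      [:: 40; 40; -32; -8; -32; -2; 1; 1; 16; 16; -23; -17; 16; 16; 16; 16;
          -32; 22; 22; -20; -20; -8];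
      [:: 52; -32; -8; 40; -8; 10; -5; -5; 4; 4; 31; 1; 4; 4; 4; 4; -8; -26;
          -26; 16; 16; -44];
      [:: 40; 40; -32; -8; -32; 40; 22; 22; 16; 16; -2; -38; 16; 16; 16; 16;
          -32; -20; -20; -20; -20; -8];
      [:: -8; -8; -2; 10; 40; -8; 4; 4; -20; -20; -8; 16; -20; -20; 22; 22;
          40; 4; 4; 4; 4; -32];
      [:: 4; 4; 1; -5; 22; 4; 40; -44; 52; -32; 4; -8; 10; 10; -11; -11; -20;
          40; -44; -44; 40; 16];
      [:: 4; 4; 1; -5; 22; 4; -44; 40; -32; 52; 4; -8; 10; 10; -11; -11; -20;
          -44; 40; 40; -44; 16];
      [:: -20; -20; 16; 4; 16; -20; 52; -32; -8; -8; -20; 40; -8; -8; -8; -8;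
          16; 52; -32; -32; 52; 4];
      [:: -20; -20; 16; 4; 16; -20; -32; 52; -8; -8; -20; 40; -8; -8; -8; -8;
          16; -32; 52; 52; -32; 4];
      [:: -8; -8; -23; 31; -2; -8; 4; 4; -20; -20; -8; 16; 22; 22; 1; 1; 40;
          4; 4; 4; 4; -32];
      [:: 16; 16; -17; 1; -38; 16; -8; -8; 40; 40; 16; -32; -2; -2; 19; 19; 4;
          -8; -8; -8; -8; -20];
      [:: -20; -20; 16; 4; 16; -20; 10; 10; -8; -8; 22; -2; -8; -8; -8; -8;
          16; -32; 52; 52; -32; 4];
      [:: -20; -20; 16; 4; 16; -20; 10; 10; -8; -8; 22; -2; -8; -8; -8; -8;
          16; 52; -32; -32; 52; 4];
      [:: -20; -20; 16; 4; 16; 22; -11; -11; -8; -8; 1; 19; -8; -8; -8; -8;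
          16; 10; 10; -32; 52; 4];
      [:: -20; -20; 16; 4; 16; 22; -11; -11; -8; -8; 1; 19; -8; -8; -8; -8;
          16; 10; 10; 52; -32; 4];
      [:: 40; 40; -32; -8; -32; 40; -20; -20; 16; 16; 40; 4; 16; 16; 16; 16;
          -32; -20; -20; -20; -20; -8];
      [:: 4; 4; 22; -26; -20; 4; 40; -44; 52; -32; 4; -8; -32; 52; 10; 10;
          -20; 40; -44; -44; 40; 16];
      [:: 4; 4; 22; -26; -20; 4; -44; 40; -32; 52; 4; -8; 52; -32; 10; 10;
          -20; -44; 40; 40; -44; 16];
      [:: 4; 4; -20; 16; -20; 4; -44; 40; -32; 52; 4; -8; 52; -32; -32; 52;
          -20; -44; 40; 40; -44; 16];
      [:: 4; 4; -20; 16; -20; 4; 40; -44; 52; -32; 4; -8; -32; 52; 52; -32;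
          -20; 40; -44; -44; 40; 16];
      [:: -32; 52; -8; -44; -8; -32; 16; 16; 4; 4; -32; -20; 4; 4; 4; 4; -8;
          16; 16; 16; 16; 40]].

Definition orders22 : 6.-tuple (seq nat) :=
  [tuple order_W1; order_W2; order_W3; order_W4; order_W5; order_W6].

(** The sums of the numbers of faces over the 2^22 rotation systems. *)
Definition totals22 : 6.-tuple N :=
  [tuple 13428448%num; 13464928%num; 13510048%num; 13499008%num; 13489888%num;
         13456768%num].

(** The base graph W5 is intertwined with itself by its adjacency matrix. *)
Definition intertwiners22 : 6.-tuple (seq (seq nat)) :=
  [tuple intertwiner_W1; intertwiner_W2; intertwiner_W3; intertwiner_W4;
         adj_rows 22 edges_W5; intertwiner_W6].

Lemma det_adjacency_G1 : \det (adjacency_mx (graph_of_edges 16 edges_G1)) != 0.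
Proof.
have c_neq0 : 6 != 0 :> int by [].
have inv : adjacency_inverse 16 edges_G1 6 inverse_G1 by vm_compute.
exact: adjacency_inverseP c_neq0 inv.
Qed.

Lemma det_adjacency_W5 : \det (adjacency_mx (graph_of_edges 22 edges_W5)) != 0.
Proof.
have c_neq0 : 84 != 0 :> int by [].
have inv : adjacency_inverse 22 edges_W5 84 inverse_W5 by vm_compute.
exact: adjacency_inverseP c_neq0 inv.
Qed.

Lemma family16_certificate (i : 'I_3) :
  graph_certificate 16 edges_G1
    (tnth [tuple edges_G1; edges_G2; edges_G3] i)
    (tnth orders16 i) (tnth totals16 i) (tnth intertwiners16 i).
Proof. by case: i => -[|[|[|//]]] lt_i; vm_compute. Qed.

Lemma family22_certificate (i : 'I_6) :
  graph_certificate 22 edges_W5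
    (tnth [tuple edges_W1; edges_W2; edges_W3; edges_W4; edges_W5; edges_W6] i)
    (tnth orders22 i) (tnth totals22 i) (tnth intertwiners22 i).
Proof. by case: i => -[|[|[|[|[|[|//]]]]]] lt_i; vm_compute. Qed.

Lemma family16_faces :
  (forall i, connected (family16 i) /\ cubic (family16 i)) /\
  (forall i j, i != j ->
     [/\ cospectral (family16 i) (family16 j),
         short_faces (family16 i) = short_faces (family16 j)
       & long_faces (family16 i) <> long_faces (family16 j)]).
Proof.
by apply: (certified_family (i0 := ord0) _ _ family16_certificate);
  [exact: det_adjacency_G1 | apply/tuple_uniqP].
Qed.

Lemma family22_faces :
  (forall i, connected (family22 i) /\ cubic (family22 i)) /\
  (forall i j, i != j ->
     [/\ cospectral (family22 i) (family22 j),
         short_faces (family22 i) = short_faces (family22 j)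
       & long_faces (family22 i) <> long_faces (family22 j)]).
Proof.
by apply: (certified_family (i0 := @Ordinal 6 4 isT) _ _ family22_certificate);
  [exact: det_adjacency_W5 | apply/tuple_uniqP].
Qed.

Theorem theoremC :
  [/\ forall G : sgraph, connected G -> cubic G ->
        short_faces G =
        \sum_(girth G <= k < 2 * girth G)
          \tr (nonbacktracking_mx G ^+ k) / (k%:R * 2%:R ^+ k),
      forall G H : sgraph,
        connected G -> cubic G -> connected H -> cubic H ->
        cospectral G H -> short_faces G = short_faces H,
      ~ (forall G H : sgraph,
           connected G -> cubic G -> connected H -> cubic H ->
           cospectral G H -> long_faces G = long_faces H),
      (forall i : 'I_3,
         connected (family16 i) /\ cubic (family16 i)) /\
      (forall i j : 'I_3, i != j ->
         [/\ cospectral (family16 i) (family16 j),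
             short_faces (family16 i) = short_faces (family16 j)
           & long_faces (family16 i) <> long_faces (family16 j)])
    & (forall i : 'I_6,
         connected (family22 i) /\ cubic (family22 i)) /\
      (forall i j : 'I_6, i != j ->
         [/\ cospectral (family22 i) (family22 j),
             short_faces (family22 i) = short_faces (family22 j)
           & long_faces (family22 i) <> long_faces (family22 j)])].
Proof.
have [conn16 faces16] := family16_faces.
split; last exact: family22_faces.
- by move=> G _; apply: short_faces_trace.
- exact: cospectral_short_faces.
- move=> long_eq; have [cosp _ []] := faces16 0 1 isT.
  have [[conn0 cub0] [conn1 cub1]] := (conn16 0, conn16 1).
  exact: long_eq.
- by split.
Qed.
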